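(* Any unimodular left-invariant Poisson tensor on a Lie group $G$ is a Killing-Poisson tensor with respect to any right-invariant Riemannian metric on $G$.
   Context: All objects are smooth. Let $\mathcal G$ be the Lie algebra of $G$. For $r\in\wedge^2\mathcal G$, let also $r:\mathcal G^*\to\mathcal G$ denote the linear map $\alpha(r(\beta))=r(\alpha,\beta)$, and let $\mathrm{Im}\,r$ be its image. $r$ is a solution of the classical Yang-Baxter equation if $[r,r]=0$, where $[r,r](\alpha,\beta,\gamma)=\alpha([r(\beta),r(\gamma)])+\beta([r(\gamma),r(\alpha)])+\gamma([r(\alpha),r(\beta)])$ for $\alpha,\beta,\gamma\in\mathcal G^*$; in that case $\mathrm{Im}\,r$ is a Lie subalgebra. Such a solution is unimodular if for every $u\in\mathrm{Im}\,r$ the trace of $\mathrm{ad}_u:\mathrm{Im}\,r\to\mathrm{Im}\,r$, $v\mapsto[u,v]$, vanishes. A left-invariant Poisson tensor on $G$ is called unimodular if its value at the unity of $G$ is a unimodular solution of the classical Yang-Baxter equation. A Poisson tensor is a bivector field $\pi$ with $[\pi,\pi]=0$ (Schouten-Nijenhuis bracket); its anchor is $\pi_\#:T^*M\to TM$, $\beta(\pi_\#(\alpha))=\pi(\alpha,\beta)$, and $f$ is a Casimir function if $\pi_\#(df)=0$. A Poisson tensor $\pi$ on a Riemannian manifold $(M,g)$ is a Killing-Poisson tensor if (i) the divergence of $\pi$ with respect to the Levi-Civita connection $\nabla$ (the vector field obtained by contracting $\nabla\pi$) vanishes, and (ii) for any open set $U\subset M$ and any Casimir function $f\in C^\infty(U)$,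 $L_{\nabla f}\pi=0$, where $\nabla f$ is the gradient of $f$. *)

(* Defs.v *)
From HB Require Import structures.
From mathcomp Require Import all_boot all_order all_algebra.
From mathcomp Require Import all_classical all_reals all_analysis.

Set Implicit Arguments.
Unset Strict Implicit.
Unset Printing Implicit Defensive.

Import Order.TTheory GRing.Theory Num.Theory.
Import numFieldNormedType.Exports.

Local Open Scope classical_set_scope.
Local Open Scope ring_scope.

(* Conventions.
   - A smooth manifold is given by an atlas indexed by its points: [chart p] is
     a chart around [p].  (Any atlas can be so indexed by choosing a chart
     around each point, without changing the smooth structure.)
   - Tangent vectors at [p] are rows ['rV_n] and covectors at [p] are columns
     ['cV_n], both written in the chart [chart p]; the pairing is [v *m alpha].
   - A vector field is thus a map [M -> 'rV_n].  A bivector field is a map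
     [P : M -> 'M_n], with P_p(alpha, beta) = alpha^T *m P p *m beta; a field of
     bilinear forms on the tangent spaces is a map [g : M -> 'M_n], with
     g_p(u, v) = u *m g p *m v^T.
   - The matrix ['J f x] of a differential acts on rows, on the right. *)

Section Coordinates.
Context {R : realType} {m : nat} {W : normedModType R}.

Definition partial (i : 'I_m) (f : 'rV[R]_m -> W) : 'rV[R]_m -> W :=
  'D_(delta_mx 0 i) f.

(* All iterated partial derivatives are differentiable (hence continuous). *)
Definition smooth_on (U : set 'rV[R]_m) (f : 'rV[R]_m -> W) : Prop :=
  forall (s : seq 'I_m) (x : 'rV[R]_m), U x ->
    differentiable (foldr partial f s) x.

End Coordinates.

(* Formulas in an open subset of R^n, for [h] a metric, [P], [Q] bivector
   fields and [X], [Y] vector fields. *)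
Section LocalFormulas.
Context {R : realType} {n : nat}.
Implicit Types (h P Q : 'rV[R]_n -> 'M[R]_n) (X Y : 'rV[R]_n -> 'rV[R]_n).

(* Levi-Civita connection: the coefficient of e_k in nabla_(e_i) e_j. *)
Definition christoffel h (k i j : 'I_n) (x : 'rV[R]_n) : R :=
  2^-1 * \sum_l invmx (h x) k l *
    (partial i (fun y => h y j l) x + partial j (fun y => h y i l) x
     - partial l (fun y => h y i j) x).

Lemma christoffel_torsion_free h k i j x : (forall y, (h y)^T = h y) ->
  christoffel h k i j x = christoffel h k j i x.
Proof.
move=> hT; rewrite /christoffel; congr (_ * _); apply: eq_bigr => l _.
congr (_ * _); congr (_ - _); first by rewrite addrC.
by congr (partial _ _ _); apply/funext => y; rewrite -[in LHS]hT mxE.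
Qed.

Lemma christoffel_metric h k i j x : (forall y, (h y)^T = h y) ->
  h x \in unitmx ->
  partial k (fun y => h y i j) x =
  \sum_l (christoffel h l k i x * h x l j + christoffel h l k j x * h x i l).
Proof.
move=> hT hU.
have sym a b : (fun y => h y a b) = (fun y => h y b a).
  by apply/funext => y; rewrite -[in LHS]hT mxE.
have low a b c : \sum_l christoffel h l a b x * h x l c =
    2^-1 * (partial a (fun y => h y b c) x + partial b (fun y => h y a c) x
     - partial c (fun y => h y a b) x).
  rewrite /christoffel.
  under eq_bigr do rewrite -mulrA mulr_suml.
  rewrite -mulr_sumr; congr (_ * _); rewrite exchange_big /=.
  under eq_bigr => e _.
    under eq_bigr do rewrite mulrAC.
    rewrite -mulr_suml.
    rewrite (_ : \sum_(l < n) _ = (e == c)%:R).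
      over.
    have /matrixP/(_ c e) := mulmxV hU.
    rewrite !mxE eq_sym => <-; apply: eq_bigr => l _; rewrite mulrC.
    have /matrixP/(_ c l) := hT x; rewrite mxE => ->.
    by [].
  rewrite (bigD1 c) //= eqxx mul1r big1 ?addr0// => e /negPf ->.
  by rewrite mul0r.
rewrite big_split /= low.
under [X in _ + X]eq_bigr => l _ do rewrite (congr1 (fun f => f x) (sym i l)).
rewrite low (sym j i) (sym k i) (sym k j).
set A := partial k _ x; set B := partial i _ x; set C := partial j _ x.
rewrite -mulrDr [A + C - B]addrAC (addrC (A + B - C)).
have -> : A - B + C + (A + B - C) = A *+ 2.
  by rewrite addrACA subrr addr0 addrACA addNr addr0 mulr2n.
by rewrite -(mulr_natl A 2) mulrA mulVf ?mul1r// ?pnatr_eq0.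
Qed.

Definition nabla_bivector h P (k i j : 'I_n) (x : 'rV[R]_n) : R :=
  partial k (fun y => P y i j) x
  + \sum_l (christoffel h i k l x * P x l j + christoffel h j k l x * P x i l).

Definition local_divergence h P (x : 'rV[R]_n) : 'rV[R]_n :=
  \row_j \sum_i nabla_bivector h P i i j x.

Definition local_schouten P Q (i j k : 'I_n) (x : 'rV[R]_n) : R :=
  let half (A B : 'rV[R]_n -> 'M[R]_n) (a b c : 'I_n) :=
    \sum_l A x l a * partial l (fun y => B y b c) x in
  half P Q i j k + half P Q j k i + half P Q k i j
  + (half Q P i j k + half Q P j k i + half Q P k i j).

Definition local_bracket X Y (x : 'rV[R]_n) : 'rV[R]_n :=
  'D_(X x) Y x - 'D_(Y x) X x.

(* (L_X P)^{ij} = X^l d_l P^{ij} - P^{lj} d_l X^i - P^{il} d_l X^j *)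
Definition local_lie_derivative X P (x : 'rV[R]_n) : 'M[R]_n :=
  'D_(X x) P x - (('J X x)^T *m P x + P x *m 'J X x).

End LocalFormulas.

HB.mixin Record isSmoothManifold (R : realType) (n : nat) M of Topological M := {
  chart_dom : M -> set M;
  chart : M -> M -> 'rV[R]_n;
  chart_inv : M -> 'rV[R]_n -> M;
  chart_dom_open : forall p, open (chart_dom p);
  chart_dom_center : forall p, chart_dom p p;
  chart_cod_open : forall p, open (chart p @` chart_dom p);
  chartK : forall p q, chart_dom p q -> chart_inv p (chart p q) = q;
  chart_continuous : forall p q, chart_dom p q -> {for q, continuous (chart p)};
  chart_inv_continuous : forall p x, (chart p @` chart_dom p) x ->
    {for x, continuous (chart_inv p)};
  chart_smooth : forall p q,
    smooth_on (chart p @` (chart_dom p `&` chart_dom q))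
      (chart q \o chart_inv p);
  manifold_hausdorff : hausdorff_space M;
  manifold_second_countable : @second_countable M
}.

#[short(type="smoothManifoldType")]
HB.structure Definition SmoothManifold (R : realType) (n : nat) :=
  {M of isSmoothManifold R n M & Topological M}.

Definition chart_cod {R : realType} {n : nat} {M : smoothManifoldType R n}
  (p : M) : set 'rV[R]_n := chart p @` chart_dom p.

Section SmoothMaps.
Context {R : realType}.

Definition smooth_map m n (M : smoothManifoldType R m)
    (N : smoothManifoldType R n) (f : M -> N) : Prop :=
  continuous f /\
  forall p q, smooth_on [set x | chart_cod p x /\ chart_dom q (f (chart_inv p x))]
    (fun x => chart q (f (chart_inv p x))).

(* Smoothness of a map from a product manifold M1 x M2, with product charts. *)
Definition smooth_map2 m1 m2 n (M1 : smoothManifoldType R m1)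
    (M2 : smoothManifoldType R m2) (N : smoothManifoldType R n)
    (f : M1 -> M2 -> N) : Prop :=
  continuous (fun z : M1 * M2 => f z.1 z.2) /\
  forall p1 p2 q,
    let F (x : 'rV[R]_(m1 + m2)) :=
      f (chart_inv p1 (lsubmx x)) (chart_inv p2 (rsubmx x)) in
    smooth_on
      [set x | [/\ chart_cod p1 (lsubmx x), chart_cod p2 (rsubmx x)
                 & chart_dom q (F x)]]
      (fun x => chart q (F x)).

Definition smooth_fun_on n (M : smoothManifoldType R n) (U : set M)
    (f : M -> R) : Prop :=
  forall p, smooth_on (chart p @` (chart_dom p `&` U))
    (fun x => f (chart_inv p x)).

Definition tangent_map m n (M : smoothManifoldType R m)
    (N : smoothManifoldType R n) (f : M -> N) (p : M) : 'M[R]_(m, n) :=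
  'J (chart (f p) \o f \o chart_inv p) (chart p p).

End SmoothMaps.

HB.mixin Record isLieGroup (R : realType) (n : nat) G
    of Group G & SmoothManifold R n G := {
  mulg_smooth : smooth_map2 (fun p q : G => (p * q)%g);
  invg_smooth : smooth_map (fun p : G => (p^-1)%g)
}.

#[short(type="lieGroupType")]
HB.structure Definition LieGroup (R : realType) (n : nat) :=
  {G of isLieGroup R n G & Group G & SmoothManifold R n G}.

Section TensorFields.
Context {R : realType} {n : nat} {M : smoothManifoldType R n}.
Implicit Types (p q : M) (P Q g : M -> 'M[R]_n) (X Y : M -> 'rV[R]_n).

Definition transition p q (x : 'rV[R]_n) : 'M[R]_n :=
  'J (chart q \o chart_inv p) x.

(* Components of tensor fields in [chart p], as functions of the coordinates;
   at the point q the field is given in [chart q]. *)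
Definition vector_in p X (x : 'rV[R]_n) : 'rV[R]_n :=
  let q := chart_inv p x in X q *m transition q p (chart q q).

Definition bivector_in p P (x : 'rV[R]_n) : 'M[R]_n :=
  let q := chart_inv p x in let A := transition q p (chart q q) in
  A^T *m P q *m A.

Definition metric_in p g (x : 'rV[R]_n) : 'M[R]_n :=
  let q := chart_inv p x in let A := transition p q x in
  A *m g q *m A^T.

Definition bivector_field P : Prop :=
  (forall p, (P p)^T = - P p) /\
  (forall p, smooth_on (chart_cod p) (bivector_in p P)).

Definition riemannian_metric g : Prop :=
  [/\ forall p, (g p)^T = g p,
      forall p (v : 'rV[R]_n), v != 0 -> 0 < (v *m g p *m v^T) 0 0
    & forall p, smooth_on (chart_cod p) (metric_in p g)].

Definition vector_bracket X Y p : 'rV[R]_n :=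
  local_bracket (vector_in p X) (vector_in p Y) (chart p p).

Definition schouten_bracket P Q p (i j k : 'I_n) : R :=
  local_schouten (bivector_in p P) (bivector_in p Q) i j k (chart p p).

Definition poisson_tensor P : Prop :=
  bivector_field P /\ forall p i j k, schouten_bracket P P p i j k = 0.

Definition lie_derivative X P p : 'M[R]_n :=
  local_lie_derivative (vector_in p X) (bivector_in p P) (chart p p).

Definition divergence g P p : 'rV[R]_n :=
  local_divergence (metric_in p g) (bivector_in p P) (chart p p).

Definition differential (f : M -> R) p : 'cV[R]_n :=
  \col_i partial i (fun x => f (chart_inv p x)) (chart p p).

(* beta (anchor P p alpha) = P_p(alpha, beta) *)
Definition anchor P p (alpha : 'cV[R]_n) : 'rV[R]_n := alpha^T *m P p.

Definition casimir P (U : set M) (f : M -> R) : Prop :=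
  smooth_fun_on U f /\ forall p, U p -> anchor P p (differential f p) = 0.

Definition gradient g (f : M -> R) p : 'rV[R]_n :=
  (differential f p)^T *m invmx (g p).

Definition killing_poisson g P : Prop :=
  [/\ poisson_tensor P,
      forall p, divergence g P p = 0
    & forall (U : set M) (f : M -> R), open U -> casimir P U f ->
        forall p, U p -> lie_derivative (gradient g f) P p = 0].

End TensorFields.

Section LieGroups.
Context {R : realType} {n : nat} {G : lieGroupType R n}.
Definition left_invariant_field (u : 'rV[R]_n) (p : G) : 'rV[R]_n :=
  u *m tangent_map (fun q : G => (p * q)%g) 1%g.

Definition left_invariant_bivector (P : G -> 'M[R]_n) : Prop :=
  forall a p : G, let T := tangent_map (fun q : G => (a * q)%g) p in
  P (a * p)%g = T^T *m P p *m T.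

Definition right_invariant_metric (g : G -> 'M[R]_n) : Prop :=
  forall a p : G, let T := tangent_map (fun q : G => (q * a)%g) p in
  g p = T *m g (p * a)%g *m T^T.

(* The Lie algebra of G is the tangent space at 1, with this bracket. *)
Definition lie_bracket (u v : 'rV[R]_n) : 'rV[R]_n :=
  vector_bracket (left_invariant_field u) (left_invariant_field v) 1%g.

(* alpha (r_map r beta) = r(alpha, beta) *)
Definition r_map (r : 'M[R]_n) (beta : 'cV[R]_n) : 'rV[R]_n := (r *m beta)^T.

Definition cybe_bracket (r : 'M[R]_n) (alpha beta gamma : 'cV[R]_n) : R :=
  (lie_bracket (r_map r beta) (r_map r gamma) *m alpha
   + lie_bracket (r_map r gamma) (r_map r alpha) *m beta
   + lie_bracket (r_map r alpha) (r_map r beta) *m gamma) 0 0.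

Definition cybe_solution (r : 'M[R]_n) : Prop :=
  r^T = - r /\ forall alpha beta gamma, cybe_bracket r alpha beta gamma = 0.

(* Since [r_map r beta = beta^T *m r^T], the image of r is the row space of
   [r^T]; [lin1_mx (lie_bracket u)] is the matrix of ad_u. *)
Definition unimodular (r : 'M[R]_n) : Prop :=
  forall beta : 'cV[R]_n,
    \tr (restrictmx r^T (lin1_mx (lie_bracket (r_map r beta)))) = 0.

Definition left_invariant_poisson (P : G -> 'M[R]_n) : Prop :=
  poisson_tensor P /\ left_invariant_bivector P.

Definition unimodular_left_invariant_poisson (P : G -> 'M[R]_n) : Prop :=
  [/\ left_invariant_poisson P, cybe_solution (P 1%g) & unimodular (P 1%g)].

End LieGroups.

(* Main.v *)
Require Import Defs.
From HB Require Import structures.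
From mathcomp Require Import all_boot all_order all_algebra.
From mathcomp Require Import all_classical all_reals all_analysis.
From mathcomp Require Import ring lra.

(** Let [X_a] be the left-invariant fields extending a basis [e_a] of the Lie
algebra and let [r] be the value of the Poisson tensor [P] at the unit, so that
[P] is the sum of the [r_ab X_a (x) X_b].  The flow of a left-invariant field
consists of right translations, which are isometries of a right-invariant
metric: every [X_a] is a Killing field.  Both conditions on [P] follow from
this.

Divergence.  Killing fields have zero divergence and the Levi-Civita connection
is torsion-free, so the divergence of [P] is the sum of the
[r_ab nabla_(X_a) X_b], which is half the sum of the [r_ab [X_a, X_b]]
([divergence_killing_frame], [sum_derive_bracket]).  The fields [X_a] bracket as
the Lie algebra does ([local_bracket_left_frame]), which leaves the element
[sum r_ab [e_a, e_b]].  Contracting the Yang-Baxter equation with an inverse of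
[r] on its image expresses the value of a covector [gamma] on this element as
twice the trace of [ad (r gamma)] on [Im r], and unimodularity kills that trace
([unimodular_rmatrix_bracket]).

Casimir functions.  Since the [X_a] form a frame, [f] is a Casimir function if
and only if the functions [sum_a r_ab X_a f] vanish.  The flow of a Killing
field commutes with the gradient: [[X_a, grad f] = grad (X_a f)].  Hence in
[L_(grad f) P] only terms with a factor [sum_a r_ab grad (X_a f)] or its mirror
image occur, and these are zero ([lie_derivative_gradient_killing]).

Everything is computed at the centre of the chart at a point [p], where the
frame [X_a] becomes the matrix-valued function [left_frame p].  That right
translations are isometries becomes, after one derivative in the translation
parameter, the Killing equation ([killing_of_isometries]); there, as in the
invariance of the bracket, two derivatives in different directions are
exchanged ([derive_mixed]). *)

Set Implicit Arguments.
Unset Strict Implicit.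
Unset Printing Implicit Defensive.

Import Order.TTheory GRing.Theory Num.Theory.
Import numFieldNormedType.Exports.

Local Open Scope classical_set_scope.
Local Open Scope ring_scope.

(** * Differentials depend on germs *)

Section Germs.
Context {R : realType} {V W : normedModType R}.

Lemma near_eq_differentiable (f g : V -> W) x :
  (\near x, f x = g x) -> differentiable f x -> differentiable g x.
Proof.
move=> fg df.
have fgx : f x = g x by exact: (nbhs_singleton fg).
have dg : g \o shift x = cst (g x) + 'd f x +o_ 0 id.
  have /diff_locallyP[_ /eqaddoP ef] := df.
  apply/eqaddoP => e e0; have := ef e e0.
  have fg0 : \forall h \near 0, f (h + x) = g (h + x).
    move: fg; rewrite (near_shift 0 x)/=; apply: filter_app; near=> h.
    by rewrite subr0.
  apply: filter_app; move: fg0; apply: filter_app; near=> h => fgh.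
  rewrite -[(f \o shift x - _) h]/(f (h + x) - (f x + 'd f x h)).
  by rewrite -[(g \o shift x - _) h]/(g (h + x) - (g x + 'd f x h)) fgh fgx.
have cdf := diff_continuous df.
apply/diff_locallyP; split; last by rewrite (diff_unique cdf dg).
by rewrite (diff_unique cdf dg).
Unshelve. all: by end_near. Qed.

Lemma derive_lin (f : V -> W) x (I : finType) (c : I -> R) (v : I -> V) :
  differentiable f x ->
  'D_(\sum_i c i *: v i) f x = \sum_i c i *: 'D_(v i) f x.
Proof.
move=> df; rewrite deriveE// linear_sum; apply: eq_bigr => i _.
by rewrite linearZ -deriveE.
Qed.

Lemma derive_comp (U : normedModType R) (f : U -> V) (g : V -> W) x v :
  differentiable f x -> differentiable g (f x) ->
  'D_v (g \o f) x = 'D_('D_v f x) g (f x).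
Proof.
move=> df dg; rewrite deriveE; last exact: differentiable_comp.
by rewrite diff_comp//= -!deriveE.
Qed.

End Germs.

(** * Differentiation of matrix-valued functions *)

Section MatrixFunctions.
Context {R : realType} {V : normedModType R}.

Lemma differentiable_mxP m n (M : V -> 'M[R]_(m, n)) x :
  differentiable M x <-> forall i j, differentiable (fun y => M y i j) x.
Proof.
split=> [dM i j|dM].
  apply: (differentiable_comp (g := fun N : 'M[R]_(m, n) => N i j : R)) => //.
  exact: differentiable_coord.
have -> : M = \sum_(i < m) \sum_(j < n) (fun y => M y i j *: delta_mx i j).
  apply/funext => y; rewrite fct_sumE [LHS]matrix_sum_delta.
  by apply: eq_bigr => i _; rewrite fct_sumE.
apply: differentiable_sum => i; apply: differentiable_sum => j.
exact: differentiableZl.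
Qed.

Lemma derive_mxE m n (M : V -> 'M[R]_(m, n)) x v i j :
  differentiable M x -> ('D_v M x) i j = 'D_v (fun y => M y i j) x.
Proof. by move=> dM; rewrite derive_mx ?mxE//; exact: diff_derivable. Qed.

Lemma differentiable_rows m k (A : V -> 'M[R]_(m, k)) z :
  (forall v : 'rV[R]_m, differentiable (fun y => v *m A y) z) -> differentiable A z.
Proof.
move=> dA; apply/differentiable_mxP => i j.
have := (differentiable_mxP _ _).1 (dA (delta_mx 0 i)) 0 j.
by under eq_fun do rewrite -rowE mxE.
Qed.

Lemma differentiable_fsum (I : finType) (f : I -> V -> R) x :
  (forall i, differentiable (f i) x) ->
  differentiable (fun y => \sum_i f i y) x.
Proof.
move=> df; rewrite (_ : (fun y => _) = \sum_i f i); last first.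
  by apply/funext => y; rewrite fct_sumE.
by elim/big_ind : _ => // g h; exact: differentiableD.
Qed.

Lemma derive_fsum (I : finType) (f : I -> V -> R) x v :
  (forall i, differentiable (f i) x) ->
  'D_v (fun y => \sum_i f i y) x = \sum_i 'D_v (f i) x.
Proof.
move=> df; rewrite (_ : (fun y => _) = \sum_i f i); last first.
  by apply/funext => y; rewrite fct_sumE.
suff [] : differentiable (\sum_i f i) x /\
  'D_v (\sum_i f i) x = \sum_i 'D_v (f i) x by [].
elim/big_ind2 : _ => [|f1 d1 f2 d2 [h1 <-] [h2 <-]|i _].
- by split=> //; exact: derive_cst.
- split; first exact: differentiableD.
  by rewrite deriveD//; exact: diff_derivable.
- by [].
Qed.

Lemma differentiable_mulr (f g : V -> R) x :
  differentiable f x -> differentiable g x ->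
  differentiable (fun y => f y * g y) x.
Proof. exact: differentiableM. Qed.

Lemma derive_mulr (f g : V -> R) x v :
  differentiable f x -> differentiable g x ->
  'D_v (fun y => f y * g y) x = 'D_v f x * g x + f x * 'D_v g x.
Proof.
move=> df dg; have := @deriveM _ _ f g x v (diff_derivable df) (diff_derivable dg).
rewrite -[f * g]/(fun y => f y * g y) => ->; rewrite addrC.
by congr (_ + _); exact: mulrC.
Qed.

Lemma differentiable_mulmx m n p (A : V -> 'M[R]_(m, n)) (B : V -> 'M[R]_(n, p)) x :
  differentiable A x -> differentiable B x ->
  differentiable (fun y => A y *m B y) x.
Proof.
move=> /differentiable_mxP dA /differentiable_mxP dB; apply/differentiable_mxP.
move=> i j; under eq_fun do rewrite mxE.
by apply: differentiable_fsum => k; exact: differentiable_mulr.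
Qed.

Lemma derive_mulmx m n p (A : V -> 'M[R]_(m, n)) (B : V -> 'M[R]_(n, p)) x v :
  differentiable A x -> differentiable B x ->
  'D_v (fun y => A y *m B y) x = 'D_v A x *m B x + A x *m 'D_v B x.
Proof.
move=> dA dB; apply/matrixP => i j.
have dAe := (differentiable_mxP _ _).1 dA.
have dBe := (differentiable_mxP _ _).1 dB.
rewrite derive_mxE; last exact: differentiable_mulmx.
under eq_fun do rewrite mxE.
rewrite derive_fsum; last by move=> k; exact: differentiable_mulr.
rewrite !mxE -big_split/=; apply: eq_bigr => k _.
by rewrite derive_mulr// !derive_mxE.
Qed.

Lemma differentiable_trmx m n (A : V -> 'M[R]_(m, n)) x :
  differentiable A x -> differentiable (fun y => (A y)^T) x.
Proof.
move=> /differentiable_mxP dA; apply/differentiable_mxP => i j.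
by under eq_fun do rewrite mxE.
Qed.

Lemma derive_trmx m n (A : V -> 'M[R]_(m, n)) x v :
  differentiable A x -> 'D_v (fun y => (A y)^T) x = ('D_v A x)^T.
Proof.
move=> dA; apply/matrixP => i j; rewrite mxE !derive_mxE//.
- by under eq_fun do rewrite mxE.
- exact: differentiable_trmx.
Qed.

Lemma differentiable_fprod (I : finType) (f : I -> V -> R) x :
  (forall i, differentiable (f i) x) ->
  differentiable (fun y => \prod_i f i y) x.
Proof.
move=> df; elim: (index_enum I) => [|i r IH].
  by under eq_fun do rewrite big_nil.
by under eq_fun do rewrite big_cons; exact: differentiable_mulr.
Qed.

Lemma differentiable_det n (A : V -> 'M[R]_n) x :
  differentiable A x -> differentiable (fun y => \det (A y)) x.
Proof.
move=> /differentiable_mxP dA; apply: differentiable_fsum => s.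
by apply: differentiable_mulr => //; exact: differentiable_fprod.
Qed.

(** Cramer's rule reduces the claim to determinants. *)
Lemma differentiable_invmx n (A : V -> 'M[R]_n) x :
  (\forall y \near x, A y \in unitmx) -> differentiable A x ->
  differentiable (fun y => invmx (A y)) x.
Proof.
move=> uA dA.
apply: (@near_eq_differentiable _ _ _ (fun y => (\det (A y))^-1 *: \adj (A y))).
  by apply: filterS uA => y Ay; rewrite /invmx Ay.
apply/differentiable_mxP => i j; under eq_fun do rewrite 2!mxE.
have dAe := (differentiable_mxP _ _).1 dA.
apply: differentiable_mulr.
  apply: differentiableV; first exact: differentiable_det.
  by have := nbhs_singleton uA; rewrite unitmxE unitfE.
rewrite /cofactor; apply: differentiable_mulr => //.
apply: differentiable_det; apply/differentiable_mxP => k l.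
by under eq_fun do rewrite !mxE.
Qed.

End MatrixFunctions.

Section Jacobian.
Context {R : realType} {m n : nat}.
Implicit Types (f : 'rV[R]_m -> 'rV[R]_n) (x v : 'rV[R]_m).

Lemma derive_delta (W : normedModType R) (f : 'rV[R]_m -> W) x v :
  differentiable f x -> 'D_v f x = \sum_i v 0 i *: partial i f x.
Proof. by move=> df; rewrite -derive_lin// -row_sum_delta. Qed.

Lemma jacobianE f x i j : differentiable f x ->
  ('J f x) i j = partial i (fun y => f y 0 j) x.
Proof.
move=> df; rewrite /partial -(derive_mxE _ _ _ df) deriveEjacobian//.
by rewrite -rowE [RHS]mxE.
Qed.

(** Lets a computation treat the Jacobian matrix as a variable [J] of which only the
derivatives are known. *)
Lemma jacobian_exists f x : differentiable f x ->
  exists2 J, 'J f x = J & forall v, 'D_v f x = v *m J.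
Proof. by move=> df; exists ('J f x); [|move=> v; exact: deriveEjacobian]. Qed.

Lemma jacobian_eq f x A : differentiable f x ->
  (forall v, 'D_v f x = v *m A) -> 'J f x = A.
Proof.
move=> du E; apply/row_matrixP => i; rewrite !rowE.
exact: etrans (esym (deriveEjacobian _ du)) (E _).
Qed.

Lemma near_eq_jacobian (u v : 'rV[R]_m -> 'rV[R]_n) x : differentiable u x ->
  (\forall y \near x, u y = v y) -> 'J u x = 'J v x.
Proof.
move=> du uv; apply: jacobian_eq => // w.
apply: etrans (near_eq_derive w uv) _.
exact: deriveEjacobian (near_eq_differentiable uv du).
Qed.

End Jacobian.

Lemma jacobian_comp (R : realType) m n k (u : 'rV[R]_m -> 'rV[R]_n)
    (v : 'rV[R]_n -> 'rV[R]_k) x : differentiable u x ->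
  differentiable v (u x) -> 'J (v \o u) x = 'J u x *m 'J v (u x).
Proof.
move=> du dv; apply: jacobian_eq => [|w]; first exact: differentiable_comp.
apply: etrans (derive_comp w du dv) _; apply: etrans (deriveEjacobian _ dv) _.
by rewrite mulmxA; congr (_ *m _); exact: deriveEjacobian.
Qed.

(** * Symmetry of second derivatives *)

Section MixedPartials.
Context {R : realType} {V : normedModType R}.
Implicit Types (f : V -> R) (x u v : V).

Lemma derive_line f x u w s :
  differentiable f (x + s *: u + w) ->
  is_derive s (1 : R) (fun s => f (x + s *: u + w)) ('D_u f (x + s *: u + w)).
Proof.
move=> df.
pose l := fun s : R => x + s *: u + w.
have dl : is_diff s l ( *:%R^~ u).
  rewrite /l (_ : (fun s => _) = cst x + ( *:%R^~ u) + cst w)//.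
  by apply: is_diff_eq; apply/funext => h /=; rewrite add0r addr0.
have dlx : differentiable l s by exact: ex_diff.
apply: DeriveDef; first by apply: diff_derivable; exact: (differentiable_comp dlx).
rewrite (@derive_comp _ _ _ _ l f s 1 dlx df); congr ('D_ _ f _).
by rewrite deriveE// diff_val scale1r.
Qed.

(** The second difference of [f] over the parallelogram at [x] with sides [t u] and
[t v]; it is symmetric in [u] and [v]. *)
Definition second_difference f x u v (t : R) :=
  f (x + t *: u + t *: v) - f (x + t *: u) - f (x + t *: v) + f x.

(** By the mean value theorem the second difference is [t] times a difference of
values of ['D_u f], which differentiability of ['D_u f] at [x] alone estimates. *)
Lemma second_difference_approx f x u v (e : R) : 0 < e ->
  (\forall y \near x, differentiable f y) -> differentiable ('D_u f) x ->
  \forall t \near 0^'+, `|second_difference f x u v t - t ^+ 2 * 'D_v ('D_u f) x|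
    <= e * t ^+ 2 * (2 * `|u| + `|v|).
Proof.
move=> e0 nf dg; set g := 'D_u f.
have [d1 d10 df] : exists2 d, 0 < d & forall k, `|k| < d -> differentiable f (x + k).
  have /nbhs_ballP[/= d d0 dP] := nf; exists d => // k kd; apply: dP.
  by rewrite -ball_normE/= opprD addrA subrr sub0r normrN.
have [d2 d20 og] : exists2 d, 0 < d & forall k, `|k| < d ->
    `|g (x + k) - (g x + 'd g x k)| <= e * `|k|.
  have /diff_locallyP[_ /eqaddoP/(_ e e0)/nbhs_ballP[/= d d0 dP]] := dg.
  exists d => // k kd; rewrite [x + k]addrC; apply: (dP k).
  by rewrite -ball_normE/= sub0r normrN.
(* The summand 1 keeps the bound positive when u and v are zero. *)
pose N := `|u| + `|v| + 1.
have N0 : 0 < N by rewrite /N ltr_wpDl// addr_ge0.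
have small (d a b t : R) : t < d / N -> 0 <= a <= t -> 0 <= b <= t ->
    `|a *: u + b *: v| < d.
  move=> td /andP[a0 at_] /andP[b0 bt].
  rewrite ltr_pdivlMr// in td; apply: le_lt_trans td.
  rewrite (le_trans (ler_normD _ _))// !normrZ !ger0_norm// /N.
  rewrite !mulrDr mulr1; have := normr_ge0 u; have := normr_ge0 v; nra.
near=> t.
have t0 : 0 < t by near: t; exact: nbhs_right_gt.
have td1 : t < d1 / N by near: t; apply: nbhs_right_lt; rewrite divr_gt0.
have td2 : t < d2 / N by near: t; apply: nbhs_right_lt; rewrite divr_gt0.
(* The two edges of the parallelogram parallel to u, run simultaneously; the
   summand 0 gives both terms the shape of derive_line. *)
pose phi := (fun s : R => f (x + s *: u + t *: v)) - (fun s : R => f (x + s *: u + 0)).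
have dphi (s : R) : 0 <= s <= t ->
    is_derive s (1 : R) phi (g (x + s *: u + t *: v) - g (x + s *: u + 0)).
  move=> st; apply: is_deriveB; apply: derive_line.
    by rewrite -addrA; apply/df/(small _ _ _ t); rewrite // lexx ltW.
  by rewrite -addrA -(scale0r v); apply/df/(small _ _ _ t); rewrite // lexx ltW.
have [c|c|c ct] := @MVT _ phi
  (fun s => g (x + s *: u + t *: v) - g (x + s *: u + 0)) 0 t t0.
- by rewrite in_itv/= => /andP[c0 ct]; apply: dphi; rewrite !ltW.
- apply: derivable_within_continuous => s; rewrite in_itv/= => st.
  by have [] := dphi _ st.
rewrite subr0 => Ephi.
have c0t : 0 <= c <= t by move: ct; rewrite in_itv/= => /andP[? ?]; rewrite !ltW.
have -> : second_difference f x u v t =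
    (g (x + c *: u + t *: v) - g (x + c *: u)) * t.
  rewrite addr0 in Ephi; rewrite -Ephi /phi /second_difference !fctE/=.
  rewrite !scale0r !addr0; ring.
have : `|g (x + c *: u + t *: v) - (g x + 'd g x (c *: u + t *: v))|
    <= e * `|c *: u + t *: v|.
  by rewrite -addrA; apply/og/(small _ _ _ t); rewrite // lexx ltW.
have : `|g (x + c *: u) - (g x + 'd g x (c *: u))| <= e * `|c *: u|.
  apply: og; rewrite -[c *: u]addr0 -(scale0r v).
  by apply: (small _ _ _ t); rewrite // lexx ltW.
have -> : 'd g x (c *: u + t *: v) = 'd g x (c *: u) + t * 'd g x v.
  by rewrite linearD; congr (_ + _); rewrite linearZ.
have -> : 'D_v g x = 'd g x v by rewrite deriveE.
set A := 'd g x _; set B := 'd g x v.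
set G1 := g (_ + _ + _); set G2 := g (x + _) => h2 h1.
have /andP[c0 ct'] := c0t.
have n1 : `|c *: u + t *: v| <= t * (`|u| + `|v|).
  rewrite (le_trans (ler_normD _ _))// !normrZ !ger0_norm ?(ltW t0)//.
  by rewrite mulrDr lerD2r ler_wpM2r.
have n2 : `|c *: u| <= t * `|u|.
  by rewrite normrZ ger0_norm// ler_wpM2r.
have -> : (G1 - G2) * t - t ^+ 2 * B =
   t * ((G1 - (g x + (A + t * B))) - (G2 - (g x + A))) by ring.
rewrite normrM (gtr0_norm t0).
have -> : e * t ^+ 2 * (2 * `|u| + `|v|) =
  t * (e * (t * (`|u| + `|v|)) + e * (t * `|u|)) by ring.
rewrite ler_wpM2l ?(ltW t0)// (le_trans (ler_normB _ _))// lerD//.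
- by rewrite (le_trans h1)// ler_wpM2l// (ltW e0).
- by rewrite (le_trans h2)// ler_wpM2l// (ltW e0).
Unshelve. all: by end_near. Qed.

(** Both iterated derivatives are the limit of the same second difference
divided by [t ^ 2]. *)
Lemma derive_mixed f x u v : (\forall y \near x, differentiable f y) ->
  differentiable ('D_u f) x -> differentiable ('D_v f) x ->
  'D_v ('D_u f) x = 'D_u ('D_v f) x.
Proof.
move=> df du dv; apply/eqP; rewrite -subr_eq0 -normr_le0.
(* The sum of the two error bounds, with 1 added to make it positive. *)
pose N := 3 * (`|u| + `|v|) + 1.
have N0 : 0 < N by rewrite ltr_wpDl// mulr_ge0// addr_ge0.
apply/ler_addgt0Pr => e e0; rewrite add0r.
have e0' : 0 < e / N by rewrite divr_gt0.
have h1 := second_difference_approx v e0' df du.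
have h2 := second_difference_approx u e0' df dv.
suff [t [t0 k1 k2]] : exists t : R, [/\ 0 < t,
   `|second_difference f x u v t - t ^+ 2 * 'D_v ('D_u f) x|
    <= e / N * t ^+ 2 * (2 * `|u| + `|v|) &
   `|second_difference f x v u t - t ^+ 2 * 'D_u ('D_v f) x|
    <= e / N * t ^+ 2 * (2 * `|v| + `|u|)].
  have sd : second_difference f x v u t = second_difference f x u v t.
    by rewrite /second_difference [x + t *: v + _]addrAC; ring.
  rewrite sd in k2; set D := second_difference _ _ _ _ _ in k1 k2.
  have t20 : 0 < t ^+ 2 by rewrite exprn_gt0.
  rewrite -(ler_pM2l t20) -[X in X * _](gtr0_norm t20) -normrM.
  set a := 'D_v _ x in k1 *; set b := 'D_u _ x in k2 *.
  have -> : t ^+ 2 * (a - b) = (D - t ^+ 2 * b) - (D - t ^+ 2 * a) by ring.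
  rewrite (le_trans (ler_normB _ _))// (le_trans (lerD k2 k1))//.
  have -> : e / N * t ^+ 2 * (2 * `|v| + `|u|) + e / N * t ^+ 2 * (2 * `|u| + `|v|)
    = t ^+ 2 * (e / N * (3 * (`|u| + `|v|))) by ring.
  rewrite (ler_pM2l t20) mulrAC (ler_pdivrMr _ _ N0) (ler_pM2l e0).
  by rewrite /N lerDl.
near (0 : R)^'+ => t; exists t; split.
- by near: t; exact: nbhs_right_gt.
- by near: t.
- by near: t.
Unshelve. all: by end_near. Qed.

End MixedPartials.

(** * Twice differentiable maps *)

Section TwiceDifferentiable.
Context {R : realType} {m n : nat}.
Implicit Types (f : 'rV[R]_m -> 'rV[R]_n) (x u v : 'rV[R]_m).

(** The hypotheses of the symmetry of second derivatives: the derivatives need to be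
differentiable at [x] only. *)
Definition twice_differentiable f x :=
  (\forall y \near x, differentiable f y) /\
  (forall v, differentiable ('D_v f) x).

Lemma smooth_on_twice_differentiable U f x : open U -> U x ->
  smooth_on U f -> twice_differentiable f x.
Proof.
move=> oU Ux sf; have nU : \forall y \near x, U y by exact: open_nbhs_nbhs.
split=> [|v]; first by apply: filterS nU => y; exact: (sf [::]).
apply: (@near_eq_differentiable _ _ _ (\sum_i (fun y => v 0 i *: partial i f y))).
  apply: filterS nU => y Uy; rewrite derive_delta ?fct_sumE//.
  exact: (sf [::]).
apply: differentiable_sum => i; apply: differentiableZ; exact: (sf [:: i]).
Qed.

Lemma twice_differentiable_diff f x : twice_differentiable f x -> differentiable f x.
Proof. by case=> /nbhs_singleton. Qed.

Lemma mul_jacobian_near f x v : (\forall y \near x, differentiable f y) ->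
  \forall y \near x, 'D_v f y = v *m 'J f y.
Proof. by apply: filterS => y; exact: deriveEjacobian. Qed.

Lemma differentiable_jacobian f x : twice_differentiable f x ->
  differentiable (fun y => 'J f y) x.
Proof.
move=> [nf df]; apply/differentiable_mxP => i j.
have := (differentiable_mxP _ _).1 (df (delta_mx 0 i)) 0 j.
apply: near_eq_differentiable; apply: filterS (mul_jacobian_near (delta_mx 0 i) nf).
by move=> y ->; rewrite -rowE [LHS]mxE.
Qed.

Lemma derive_jacobian f x u v : twice_differentiable f x ->
  v *m 'D_u (fun y => 'J f y) x = 'D_u ('D_v f) x.
Proof.
move=> d2f; have [nf df] := d2f.
rewrite (near_eq_derive u (mul_jacobian_near v nf)).
rewrite (derive_mulmx u (differentiable_cst _ _) (differentiable_jacobian d2f)).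
by rewrite derive_cst mul0mx add0r.
Qed.

Lemma derive_mixed_row f x u v : twice_differentiable f x ->
  'D_u ('D_v f) x = 'D_v ('D_u f) x.
Proof.
move=> [nf df]. apply/rowP => j.
have E1 := derive_mxE u 0 j (df v).
have E2 := derive_mxE v 0 j (df u).
apply: (etrans E1); apply: (etrans _ (esym E2)).
have near_entry w : \forall y \near x, ('D_w f y) 0 j = 'D_w (fun y => f y 0 j) y.
  by apply: filterS nf => y dfy; exact: derive_mxE.
rewrite (near_eq_derive u (near_entry v)) (near_eq_derive v (near_entry u)).
apply: derive_mixed.
- by apply: filterS nf => y /differentiable_mxP; exact.
- apply: near_eq_differentiable (near_entry v) _.
  by have /differentiable_mxP := df v; exact.
- apply: near_eq_differentiable (near_entry u) _.
  by have /differentiable_mxP := df u; exact.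
Qed.

End TwiceDifferentiable.

Lemma derive_affine (R : realType) m k (A : 'M[R]_(m, k)) b (x v : 'rV[R]_m) :
  differentiable (fun x => x *m A + b) x /\
  'D_v (fun x => x *m A + b) x = v *m A.
Proof.
have di : differentiable (id : 'rV[R]_m -> 'rV[R]_m) x by exact: ex_diff.
have dA := differentiable_mulmx di (differentiable_cst A x).
have db := differentiable_cst b x.
split; first exact: differentiableD dA db.
apply: etrans (deriveD (diff_derivable dA) (diff_derivable db)) _.
rewrite (derive_mulmx v di (differentiable_cst A x)) !derive_cst mulmx0 !addr0.
by rewrite derive_id.
Qed.

(** ** Slices of maps of two variables

A map of two variables in [R^n] is a map on ['rV_(n + n)]; these lemmas relate
its derivatives along the two factors to the derivatives of its slices. *)

Section Slices.
Context {R : realType} {n : nat}.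

Lemma derive_row_mxl m k (y : 'rV[R]_k) (x v : 'rV[R]_m) :
  differentiable (fun x : 'rV[R]_m => row_mx x y) x /\
  'D_v (fun x : 'rV[R]_m => row_mx x y) x = row_mx v 0.
Proof.
have -> : (fun x : 'rV[R]_m => row_mx x y) =
    (fun x => x *m row_mx 1%:M 0 + row_mx 0 y).
  by apply/funext => z; rewrite mul_mx_row mulmx1 mulmx0 add_row_mx addr0 add0r.
have [dr ->] := derive_affine (row_mx 1%:M 0) (row_mx 0 y) x v.
by rewrite mul_mx_row mulmx1 mulmx0.
Qed.

Lemma derive_row_mxr m k (y : 'rV[R]_k) (x v : 'rV[R]_m) :
  differentiable (fun x : 'rV[R]_m => row_mx y x) x /\
  'D_v (fun x : 'rV[R]_m => row_mx y x) x = row_mx 0 v.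
Proof.
have -> : (fun x : 'rV[R]_m => row_mx y x) =
    (fun x => x *m row_mx 0 1%:M + row_mx y 0).
  by apply/funext => z; rewrite mul_mx_row mulmx1 mulmx0 add_row_mx addr0 add0r.
have [dr ->] := derive_affine (row_mx 0 1%:M) (row_mx y 0) x v.
by rewrite mul_mx_row mulmx1 mulmx0.
Qed.

Lemma derive_slicel (F : 'rV[R]_(n + n) -> 'rV[R]_n) (x y v : 'rV[R]_n) :
  differentiable F (row_mx x y) ->
  differentiable (fun x => F (row_mx x y)) x /\
  v *m 'J (fun x => F (row_mx x y)) x = 'D_(row_mx v 0) F (row_mx x y).
Proof.
move=> dF; have [dr Dr] := derive_row_mxl y x v.
have dFr : differentiable (fun x => F (row_mx x y)) x.
  exact: differentiable_comp dr dF.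
split=> //; rewrite -(deriveEjacobian v dFr) -Dr.
exact: derive_comp v dr dF.
Qed.

Lemma derive_slicer (F : 'rV[R]_(n + n) -> 'rV[R]_n) (x y v : 'rV[R]_n) :
  differentiable F (row_mx x y) ->
  differentiable (fun y => F (row_mx x y)) y /\
  v *m 'J (fun y => F (row_mx x y)) y = 'D_(row_mx 0 v) F (row_mx x y).
Proof.
move=> dF; have [dr Dr] := derive_row_mxr x y v.
have dFr : differentiable (fun y => F (row_mx x y)) y.
  exact: differentiable_comp dr dF.
split=> //; rewrite -(deriveEjacobian v dFr) -Dr.
exact: derive_comp v dr dF.
Qed.

Lemma differentiable_jacobian_slice (F : 'rV[R]_(n + n) -> 'rV[R]_n)
    (x y : 'rV[R]_n) :
  twice_differentiable F (row_mx x y) ->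
  differentiable (fun x => 'J (fun y => F (row_mx x y)) y) x.
Proof.
move=> [nF dF]; apply: differentiable_rows => v.
have [dr _] := derive_row_mxl y x 0.
have := differentiable_comp dr (dF (row_mx 0 v)).
apply: near_eq_differentiable.
have nF' : \forall z \near x, differentiable F (row_mx z y).
  exact: (differentiable_continuous dr nF).
by apply: filterS nF' => z dFz; have [_ ->] := derive_slicer v dFz.
Qed.

Lemma twice_differentiable_slicer (F : 'rV[R]_(n + n) -> 'rV[R]_n)
    (x y : 'rV[R]_n) :
  twice_differentiable F (row_mx x y) ->
  twice_differentiable (fun y => F (row_mx x y)) y.
Proof.
move=> [nF dF]; have [dr _] := derive_row_mxr x y 0.
have nFr : \forall z \near y, differentiable F (row_mx x z).
  exact: (differentiable_continuous dr nF).
split; first by apply: filterS nFr => z /(derive_slicer 0)[].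
move=> v; have := differentiable_comp dr (dF (row_mx 0 v)).
apply: near_eq_differentiable; apply: filterS nFr => z dFz.
have [dz Dz] := derive_slicer v dFz.
exact: etrans (esym Dz) (esym (deriveEjacobian _ dz)).
Qed.

End Slices.

(** * Brackets of related vector fields *)

Section Bracket.
Context {R : realType} {n : nat}.
Implicit Types (Phi : 'rV[R]_n -> 'M[R]_n) (x u v : 'rV[R]_n).

Lemma derive_frame Phi x u v : differentiable Phi x ->
  'D_v (fun y => u *m Phi y) x = u *m 'D_v Phi x.
Proof.
move=> dP; rewrite (derive_mulmx v (differentiable_cst _ _) dP).
by rewrite derive_cst mul0mx add0r.
Qed.

Lemma differentiable_frame Phi x u : differentiable Phi x ->
  differentiable (fun y => u *m Phi y) x.
Proof. move=> dP; apply: differentiable_mulmx => //; exact: differentiable_cst. Qed.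

Lemma local_bracket_frame Phi x u v : differentiable Phi x ->
  local_bracket (fun y => u *m Phi y) (fun y => v *m Phi y) x =
  v *m 'D_(u *m Phi x) Phi x - u *m 'D_(v *m Phi x) Phi x.
Proof. by move=> dP; rewrite /local_bracket !derive_frame. Qed.

(** The bracket is natural for [phi]: the terms with a second derivative of [phi] are
symmetric in the two fields, so they cancel. *)
Lemma local_bracket_related Phi1 Phi2 (phi : 'rV[R]_n -> 'rV[R]_n) y u v :
  twice_differentiable phi y -> differentiable Phi1 y ->
  differentiable Phi2 (phi y) ->
  (\forall z \near y, Phi2 (phi z) = Phi1 z *m 'J phi z) ->
  local_bracket (fun x => u *m Phi2 x) (fun x => v *m Phi2 x) (phi y) =
  local_bracket (fun x => u *m Phi1 x) (fun x => v *m Phi1 x) y *m 'J phi y.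
Proof.
move=> d2 d1 d2P rel; have dphi := twice_differentiable_diff d2.
have [D DC key] : exists2 D : 'rV[R]_n -> 'rV[R]_n -> 'rV[R]_n,
    forall a b, D a b = D b a &
    forall a b, b *m 'D_(a *m Phi2 (phi y)) Phi2 (phi y) =
      b *m 'D_(a *m Phi1 y) Phi1 y *m 'J phi y + D a b.
  exists (fun a b => 'D_(a *m Phi1 y) ('D_(b *m Phi1 y) phi) y) => a b.
    exact: derive_mixed_row.
  rewrite (nbhs_singleton rel) mulmxA -(deriveEjacobian (a *m Phi1 y) dphi).
  rewrite -(derive_comp _ dphi d2P).
  rewrite (near_eq_derive _ rel) derive_mulmx//; last exact: differentiable_jacobian.
  rewrite mulmxDr mulmxA [b *m (Phi1 y *m _)]mulmxA; congr (_ + _).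
  exact: derive_jacobian.
rewrite (local_bracket_frame u v d2P) (local_bracket_frame u v d1) mulmxBl.
have cancel (X Y Z : 'rV[R]_n) : X + Z - (Y + Z) = X - Y.
  by rewrite opprD addrACA subrr addr0.
by rewrite (key u v) (key v u) (DC v u); exact: cancel.
Qed.

Lemma near_eq_local_bracket (X Y X' Y' : 'rV[R]_n -> 'rV[R]_n) x :
  (\forall y \near x, X y = X' y) -> (\forall y \near x, Y y = Y' y) ->
  local_bracket X Y x = local_bracket X' Y' x.
Proof.
move=> nX nY; rewrite /local_bracket (nbhs_singleton nX) (nbhs_singleton nY).
by congr (_ - _); exact: near_eq_derive.
Qed.

End Bracket.

(** * Unimodular solutions of the Yang-Baxter equation *)

(** Here [X] and [Y] are generalized inverses of [r], and [X r], [Y r] are projections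
onto its row space along possibly different complements; the first hypothesis
says that [L] preserves this row space, so that both traces are that of the
restriction of [L]. *)
Lemma mxtrace_ginv (F : fieldType) n (r L X Y M : 'M[F]_n) : r *m L = M *m r ->
  r *m X *m r = r -> r *m Y *m r = r ->
  \tr (L *m X *m r) = \tr (L *m Y *m r).
Proof.
move=> stab rX rY.
have -> : L *m X *m r = L *m X *m r *m Y *m r.
  by rewrite -{1}rY !mulmxA.
rewrite mxtrace_mulC !mulmxA stab -[M *m r *m X]mulmxA -[M *m (r *m X) *m r]mulmxA.
by rewrite rX -stab [RHS]mxtrace_mulC mulmxA.
Qed.

(** With [r X r = r], the trace of [r B] is that of [r B r X], and the hypothesis turns
[r B r X] into two terms, each minus the trace of [L] on the image of [r]. *)
Lemma mxtrace_rmatrix (F : fieldType) n (r L B : 'M[F]_n) : r^T = - r ->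
  r *m L + L^T *m r + r *m B *m r = 0 ->
  \tr (restrictmx r^T L) = 0 -> \tr (r *m B) = 0.
Proof.
move=> rT eqr; rewrite /conjmx; set E := row_base r^T; set P := pinvmx E => tr0.
have rPE : r *m P *m E = r by rewrite mulmxKpV// eq_row_base rT eqmx_opp.
have /submxP[C EC] : (E <= r)%MS by rewrite eq_row_base rT eqmx_opp.
have {P E C EC tr0 rPE} [X rX t0] :
    exists2 X, r *m X *m r = r & \tr (L *m X *m r) = 0.
  clearbody P; exists (P *m C).
    by rewrite !mulmxA -[_ *m C *m r]mulmxA -EC.
  by rewrite -mulmxA -[P *m C *m r]mulmxA -EC mulmxA mxtrace_mulC mulmxA.
(* Transposing gives a second generalized inverse, because r is antisymmetric. *)
have rY : r *m - X^T *m r = r.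
  have := congr1 trmx rX; rewrite !trmx_mul rT !(mulmxN, mulNmx) opprK mulmxA.
  by move=> ->; rewrite opprK.
have rBr : r *m B *m r = - (r *m L + L^T *m r).
  by apply/eqP; rewrite -addr_eq0 addrC eqr.
have stab : r *m L = (- (L^T + r *m B)) *m r.
  by rewrite mulNmx mulmxDl rBr opprD opprK addrC addrK.
have -> : r *m B = r *m X *m (r *m B) by rewrite mulmxA rX.
rewrite mxtrace_mulC mulmxA rBr mulNmx mulmxDl linearN linearD/=.
have -> : \tr (r *m L *m X) = \tr (L *m X *m r).
  by rewrite -mulmxA mxtrace_mulC.
have -> : \tr (L^T *m r *m X) = \tr (L *m (- X^T) *m r).
  rewrite -mxtrace_tr !trmx_mul trmxK rT mulmxN mulNmx mulmxN mulNmx mulmxA.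
  by rewrite !linearN/= mxtrace_mulC mulmxA.
by rewrite -(mxtrace_ginv stab rX rY) t0 addr0 oppr0.
Qed.

(** Let [gamma] be a covector, [B] the matrix of the form [gamma [u, v]] and [L] that
of [ad (r gamma)].  The Yang-Baxter equation with third argument [gamma] is then
the matrix identity [r L + L^T r + r B r = 0], while [gamma] takes the value
[- tr (r B)] on the sum. *)
Lemma unimodular_rmatrix_bracket (R : realType) n
    (br : 'rV[R]_n -> 'rV[R]_n -> 'rV[R]_n) (r : 'M[R]_n) :
  (forall v, linear (br ^~ v)) -> (forall u v, br u v = - br v u) ->
  r^T = - r ->
  (forall alpha beta gamma,
    (br (r_map r beta) (r_map r gamma) *m alpha
     + br (r_map r gamma) (r_map r alpha) *m beta
     + br (r_map r alpha) (r_map r beta) *m gamma) 0 0 = 0) ->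
  (forall beta, \tr (restrictmx r^T (lin1_mx (br (r_map r beta)))) = 0) ->
  \sum_a \sum_b r a b *: br (delta_mx 0 a) (delta_mx 0 b) = 0.
Proof.
move=> br_linear brC rT cybe unim.
have br_linear_r u : linear (br u).
  by move=> a v w; rewrite brC br_linear opprD -scalerN -!(brC u).
pose brr u : {linear 'rV[R]_n -> 'rV_n} :=
  HB.pack (br u) (GRing.isLinear.Build _ _ _ _ _ (br_linear_r u)).
pose brl v : {linear 'rV[R]_n -> 'rV_n} :=
  HB.pack (br ^~ v) (GRing.isLinear.Build _ _ _ _ _ (br_linear v)).
have brlE u v : br u v = \sum_a u 0 a *: br (delta_mx 0 a) v.
  rewrite {1}[u]row_sum_delta -[LHS]/(brl v _) linear_sum.
  by apply: eq_bigr => a _; rewrite linearZ.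
have brE u v : br u v = v *m lin1_mx (br u).
  exact/esym/(mul_rV_lin1 (brr u) v).
suff w0 (gamma : 'cV[R]_n) :
    \sum_a \sum_b r a b *: br (delta_mx 0 a) (delta_mx 0 b) *m gamma =
    (0 : 'M[R]_1).
  apply/rowP => j; have /matrixP/(_ 0 0) := w0 (delta_mx j 0).
  rewrite !mxE => <-; rewrite !summxE; apply: eq_bigr => a _.
  rewrite !summxE; apply: eq_bigr => b _.
  by rewrite -colE !mxE.
pose B : 'M[R]_n := \matrix_(a, b) (br (delta_mx 0 a) (delta_mx 0 b) *m gamma) 0 0.
have brrE u v : br u v = \sum_b v 0 b *: br u (delta_mx 0 b).
  rewrite {1}[v]row_sum_delta -[LHS]/(brr u _) linear_sum.
  by apply: eq_bigr => b _; rewrite linearZ.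
have BE u v : br u v *m gamma = u *m B *m v^T.
  rewrite -mulmxA brlE mulmx_suml; apply/matrixP => i j; rewrite !ord1.
  rewrite summxE [RHS]mxE; apply: eq_bigr => a _.
  rewrite -scalemxAl mxE; congr (_ * _).
  rewrite brrE mulmx_suml summxE mxE; apply: eq_bigr => b _.
  by rewrite -scalemxAl mxE [RHS]mulrC [v^T _ _]mxE [B _ _]mxE.
pose L := lin1_mx (br (r_map r gamma)).
have eqr : r *m L + L^T *m r + r *m B *m r = 0.
  apply/matrixP => i j; rewrite [RHS]mxE.
  pose al : 'cV[R]_n := delta_mx i 0; pose be : 'cV[R]_n := delta_mx j 0.
  have -> : (r *m L + L^T *m r + r *m B *m r) i j =
      (al^T *m (r *m L + L^T *m r + r *m B *m r) *m be) 0 0.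
    by rewrite /al trmx_delta -rowE -colE !mxE.
  have E1 : (br (r_map r be) (r_map r gamma) *m al) 0 0 =
      - (al^T *m (L^T *m r) *m be) 0 0.
    rewrite brC brE -/L mulNmx mxE; congr (- _).
    have trE (A : 'M[R]_1) : A 0 0 = A^T 0 0 by rewrite mxE.
    by rewrite [LHS]trE !trmx_mul /r_map trmxK !mulmxA.
  have E2 : (br (r_map r gamma) (r_map r al) *m be) 0 0 =
      - (al^T *m (r *m L) *m be) 0 0.
    by rewrite brE -/L /r_map trmx_mul rT mulmxN !mulNmx mxE !mulmxA.
  have E3 : (br (r_map r al) (r_map r be) *m gamma) 0 0 =
      - (al^T *m (r *m B *m r) *m be) 0 0.
    by rewrite BE /r_map trmxK trmx_mul rT mulmxN !mulNmx mxE !mulmxA.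
  apply/eqP; rewrite -oppr_eq0; apply/eqP.
  rewrite -[RHS](cybe al be gamma) 2!mulmxDr 2!mulmxDl.
  have addE (A1 A2 : 'M[R]_1) : (A1 + A2) 0 0 = A1 0 0 + A2 0 0 by rewrite mxE.
  by rewrite !addE E1 E2 E3 !opprD [X in X + _]addrC.
have tr0 : \tr (r *m B) = 0 by apply: mxtrace_rmatrix eqr _; [|exact: unim].
apply/matrixP => i j; rewrite !ord1 [RHS]mxE -[RHS]oppr0 -tr0 summxE.
have -> : - \tr (r *m B) = \tr (B *m r^T).
  by rewrite [RHS]mxtrace_mulC rT mulNmx linearN.
apply: eq_bigr => a _.
rewrite summxE [RHS]mxE; apply: eq_bigr => b _.
by rewrite -scalemxAl mxE [B _ _]mxE [r^T _ _]mxE mulrC.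
Qed.

(** * Frames of Killing fields in coordinates *)

Section LocalKilling.
Context {R : realType} {n : nat}.
Implicit Types (h Phi P : 'rV[R]_n -> 'M[R]_n) (x u v : 'rV[R]_n).

(** The vanishing at [x] of the Lie derivative of [h] along [X]. *)
Definition killing_at h (X : 'rV[R]_n -> 'rV[R]_n) x :=
  'D_(X x) h x + ('J X x *m h x + h x *m ('J X x)^T) = 0.

(** The contracted Christoffel symbol is the logarithmic derivative of the volume
density of [h]. *)
Lemma sum_christoffel h l x : (forall y, (h y)^T = h y) -> differentiable h x ->
  \sum_i christoffel h i i l x = 2^-1 * \tr (invmx (h x) *m partial l h x).
Proof.
move=> hT dh.
have iT : (invmx (h x))^T = invmx (h x) by rewrite trmx_inv hT.
have iC i j : invmx (h x) i j = invmx (h x) j i by rewrite -[in LHS]iT mxE.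
have hC i j : (fun y => h y i j) = (fun y => h y j i).
  by apply/funext => y; rewrite -[in LHS]hT mxE.
rewrite /christoffel -mulr_sumr; congr (_ * _).
pose d i m := partial i (fun y => h y l m) x.
transitivity (\sum_i \sum_m (invmx (h x) i m * d i m - invmx (h x) m i * d m i
    + invmx (h x) i m * partial l (fun y => h y m i) x)).
  apply: eq_bigr => i _; apply: eq_bigr => m _.
  rewrite (iC m i) /d [in RHS](hC m i) [in partial m (fun y => h y l i)](hC l i).
  by rewrite !mulrDr mulrN addrAC.
under eq_bigr do rewrite big_split sumrB/=.
rewrite big_split sumrB/= [X in _ - X]exchange_big/= subrr add0r.
apply: eq_bigr => i _; rewrite mxE; apply: eq_bigr => m _.
by congr (_ * _); exact/esym/derive_mxE.
Qed.

(** In terms of the volume density this says that a Killing field has zero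
divergence. *)
Lemma mxtrace_killing h X x : h x \in unitmx -> (h x)^T = h x -> killing_at h X x ->
  \tr (invmx (h x) *m 'D_(X x) h x) = - (\tr ('J X x) *+ 2).
Proof.
move=> hU hT /eqP; rewrite addr_eq0 => /eqP ->; rewrite mulmxN linearN/=; congr (- _).
rewrite mulmxDr linearD/= mulmxA mxtrace_mulC mulmxA mulmxV// mul1mx.
by rewrite mulmxA mulVmx// mul1mx mxtrace_tr mulr2n.
Qed.

(** In coordinates the divergence of [P] is its naive divergence plus the contraction
of [P] with the contracted Christoffel symbol.  As the fields are Killing, that
contraction cancels the terms that contain a divergence [c a] of a frame field. *)
Lemma divergence_killing_frame h Phi r P x : r^T = - r ->
  (\near x, P x = (Phi x)^T *m r *m Phi x) ->
  differentiable Phi x -> differentiable h x ->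
  (forall y, (h y)^T = h y) -> h x \in unitmx ->
  (forall u, killing_at h (fun y => u *m Phi y) x) ->
  local_divergence h P x = \sum_a \sum_b r a b *:
    'D_(delta_mx 0 a *m Phi x) (fun y => delta_mx 0 b *m Phi y) x.
Proof.
move=> rT nP dPhi dh hT hU kil.
have Px := nbhs_singleton nP.
have PT : (P x)^T = - P x by rewrite Px !trmx_mul trmxK rT mulNmx mulmxN mulmxA.
have dT := differentiable_trmx dPhi.
have dTr := differentiable_mulmx dT (differentiable_cst r x).
have dP : differentiable P x.
  apply: near_eq_differentiable (_ : \near x, (Phi x)^T *m r *m Phi x = P x) _.
    by apply: filterS nP => y ->.
  exact: differentiable_mulmx dTr dPhi.
have DP i : partial i P x =
    (partial i Phi x)^T *m r *m Phi x + (Phi x)^T *m r *m partial i Phi x.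
  rewrite /partial (near_eq_derive _ nP) (derive_mulmx _ dTr dPhi).
  rewrite (derive_mulmx _ dT (differentiable_cst r x)) derive_cst mulmx0 addr0.
  by rewrite (derive_trmx _ dPhi).
apply/rowP => j.
pose c a := \tr ('J (fun y => delta_mx 0 a *m Phi y) x).
have -> : local_divergence h P x 0 j =
   \sum_i ((partial i Phi x)^T *m r *m Phi x) i j +
   \sum_i ((Phi x)^T *m r *m partial i Phi x) i j +
   \sum_l (\sum_i christoffel h i i l x) * P x l j.
  rewrite mxE /nabla_bivector.
  under eq_bigr => i _.
    rewrite big_split/= [partial _ _ _](_ : _ = (partial i P x) i j); last first.
      by exact/esym/derive_mxE.
    rewrite DP mxE addrA.
    over.
  rewrite big_split/= big_split big_split/= -[RHS]addr0; congr (_ + _ + _).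
    by rewrite exchange_big/=; apply: eq_bigr => l _; rewrite mulr_suml.
  (* The other Christoffel term contracts a symmetric symbol with P. *)
  set S := LHS.
  suff SN : S = - S.
    have /eqP : S *+ 2 = 0 by rewrite mulr2n {1}SN addNr.
    by rewrite mulrn_eq0 => /eqP.
  rewrite {1}/S exchange_big /S -sumrN; apply: eq_bigr => l _; rewrite -sumrN.
  apply: eq_bigr => i _; rewrite -mulrN (christoffel_torsion_free _ _ _ _ hT).
  by congr (_ * _); move/matrixP: PT => /(_ l i); rewrite !mxE.
have -> : \sum_i ((partial i Phi x)^T *m r *m Phi x) i j =
    \sum_a c a * (r *m Phi x) a j.
  transitivity (\sum_i \sum_a (partial i Phi x) a i * (r *m Phi x) a j).
    apply: eq_bigr => i _; rewrite -mulmxA mxE; apply: eq_bigr => a _.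
    by congr (_ * _); rewrite mxE.
  rewrite exchange_big/=; apply: eq_bigr => a _; rewrite -mulr_suml.
  congr (_ * _); apply: eq_bigr => i _.
  rewrite jacobianE; last exact: differentiable_frame.
  apply/esym/(etrans (esym (derive_mxE _ _ _ (differentiable_frame _ dPhi)))).
  by rewrite derive_frame// -rowE [LHS]mxE.
have -> : \sum_l (\sum_i christoffel h i i l x) * P x l j =
    - \sum_a c a * (r *m Phi x) a j.
  under eq_bigr do rewrite sum_christoffel//.
  transitivity (\sum_l \sum_a 2^-1 * (Phi x a l *
      \tr (invmx (h x) *m partial l h x)) * (r *m Phi x) a j).
    apply: eq_bigr => l _; rewrite Px -mulmxA mxE mulr_sumr; apply: eq_bigr => a _.
    by rewrite [(Phi x)^T _ _]mxE; ring.
  rewrite exchange_big/= -sumrN; apply: eq_bigr => a _.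
  rewrite -mulr_suml -mulNr; congr (_ * _); rewrite -mulr_sumr.
  have tk := mxtrace_killing hU (hT x) (kil (delta_mx 0 a)).
  transitivity (2^-1 * \tr (invmx (h x) *m 'D_(delta_mx 0 a *m Phi x) h x)).
    congr (_ * _); rewrite derive_delta// mulmx_sumr linear_sum.
    apply: eq_bigr => l _; rewrite -scalemxAr linearZ/=; congr (_ * _).
    by rewrite -rowE [RHS]mxE.
  by rewrite tk -/(c a) mulrN -(mulr_natl (c a) 2) mulrA mulVf ?mul1r// pnatr_eq0.
rewrite addrAC subrr add0r.
transitivity (\sum_i \sum_a Phi x a i * (r *m partial i Phi x) a j).
  apply: eq_bigr => i _; rewrite -mulmxA mxE; apply: eq_bigr => a _.
  by rewrite [(Phi x)^T _ _]mxE.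
rewrite exchange_big/= summxE; apply: eq_bigr => a _.
rewrite summxE.
transitivity (\sum_b \sum_i Phi x a i * (r a b * partial i Phi x b j)).
  by rewrite exchange_big/=; apply: eq_bigr => i _; rewrite mxE mulr_sumr.
apply: eq_bigr => b _; rewrite [RHS]mxE derive_frame// -rowE [row b _ _ _]mxE.
rewrite derive_delta// summxE mulr_sumr; apply: eq_bigr => i _.
have scaleE k (A : 'M[R]_n) : (k *: A) b j = k * A b j by rewrite mxE.
by rewrite -rowE scaleE [row a _ _ _]mxE; ring.
Qed.

Lemma sum_derive_bracket Phi r x : r^T = - r ->
  \sum_a \sum_b r a b *: local_bracket (fun y => delta_mx 0 a *m Phi y)
     (fun y => delta_mx 0 b *m Phi y) x =
  (\sum_a \sum_b r a b *:
    'D_(delta_mx 0 a *m Phi x) (fun y => delta_mx 0 b *m Phi y) x) *+ 2.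
Proof.
move=> rT; have rC a b : r a b = - r b a by move/matrixP: rT => /(_ b a); rewrite !mxE.
under eq_bigr do under eq_bigr do rewrite /local_bracket scalerBr.
under eq_bigr do rewrite sumrB.
rewrite sumrB [X in _ - X]exchange_big/= mulr2n; congr (_ + _); rewrite -sumrN.
apply: eq_bigr => a _; rewrite -sumrN; apply: eq_bigr => b _.
by rewrite rC scaleNr opprK.
Qed.

(** [Z] is the gradient field of a function with differential [d], whose Jacobian
matrix is a Hessian.  The rows of [W] below are the brackets of the frame fields
with [Z]; the Killing equation identifies them with the gradients of the
functions [Phi d], which [r] annihilates. *)
Lemma lie_derivative_gradient_killing h Phi r P (d : 'rV[R]_n -> 'cV[R]_n) Z x :
  r^T = - r -> (\near x, P x = (Phi x)^T *m r *m Phi x) ->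
  differentiable Phi x -> differentiable h x ->
  (forall y, (h y)^T = h y) -> (\near x, h x \in unitmx) ->
  (forall u, killing_at h (fun y => u *m Phi y) x) ->
  differentiable d x ->
  ('J (fun y => (d y)^T) x)^T = 'J (fun y => (d y)^T) x ->
  (\near x, Z x = (d x)^T *m invmx (h x)) ->
  (\near x, r *m (Phi x *m d x) = 0) ->
  local_lie_derivative Z P x = 0.
Proof.
move=> rT nP dPhi dh hT nhU kil dd Hsym nZ nrd.
have hU := nbhs_singleton nhU.
have dT := differentiable_trmx dPhi.
have dTr := differentiable_mulmx dT (differentiable_cst r x).
have dti := differentiable_trmx dd.
have dZ : differentiable Z x.
  apply: near_eq_differentiable (_ : \near x, (d x)^T *m invmx (h x) = Z x) _.
    by apply: filterS nZ => y ->.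
  exact: differentiable_mulmx dti (differentiable_invmx nhU dh).
have nZh : \near x, Z x *m h x = (d x)^T.
  near=> y; rewrite (near nZ y)// mulmxKV//; near: y; exact: nhU.
have [K eqK EK] : exists2 K, 'J Z x = K & forall v, 'D_v Z x = v *m K.
  exact: jacobian_exists.
have [H HT EH] : exists2 H : 'M[R]_n, H^T = H &
    forall v, 'D_v (fun y => (d y)^T) x = v *m H.
  by have [H eqH EH] := jacobian_exists dti; exists H => //; rewrite -eqH.
clear Hsym.
pose W := Phi x *m K - 'D_(Z x) Phi x.
have dPd := differentiable_mulmx dPhi dd.
(* Row a: differentiate Z h = d^T along X_a and replace the derivative of h by
   means of the Killing equation. *)
have Wh i : col i (W *m h x) = 'D_(delta_mx 0 i) (fun y => Phi y *m d y) x.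
  apply/colP => a; rewrite mxE.
  pose X y := delta_mx 0 a *m Phi y : 'rV[R]_n.
  have dX : differentiable X x by exact: differentiable_frame.
  have [JX eqJ EJ] : exists2 J, 'J X x = J & forall v, 'D_v X x = v *m J.
    exact: jacobian_exists.
  have rowW : row a W *m h x = X x *m H + (d x)^T *m JX^T.
    have K1 : X x *m K *m h x + Z x *m 'D_(X x) h x = X x *m H.
      rewrite -EK -EH; apply: etrans (esym (derive_mulmx (X x) dZ dh)) _.
      exact: near_eq_derive.
    have K2 : Z x *m 'D_(X x) h x = - ('D_(Z x) X x *m h x) - (d x)^T *m JX^T.
      have := kil (delta_mx 0 a); rewrite /killing_at -/X eqJ.
      move=> /eqP; rewrite addr_eq0 => /eqP ->.
      by rewrite mulmxN mulmxDr opprD !mulmxA (nbhs_singleton nZh) EJ.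
    have -> : row a W = X x *m K - 'D_(Z x) X x.
      by rewrite rowE mulmxBr mulmxA (derive_frame _ _ dPhi).
    have alg (A B C : 'rV[R]_n) : A - B = A + (- B - C) + C by rewrite addrA subrK.
    by rewrite mulmxBl -K1 K2; exact: alg.
  have rowE0 m p (A : 'M[R]_(m, p)) k l :
      A k l = ((delta_mx 0 k : 'rV[R]_m) *m A) 0 l.
    by rewrite -rowE [RHS]mxE.
  have trE (A : 'M[R]_1) : A 0 0 = A^T 0 0 by rewrite mxE.
  transitivity ((row a W *m h x) 0 i); first by rewrite -row_mul [RHS]mxE.
  rewrite rowW (derive_mulmx _ dPhi dd) [LHS]mxE [RHS]mxE addrC; congr (_ + _).
    have -> : ((d x)^T *m JX^T) 0 i = (JX *m d x) i 0 by rewrite -trmx_mul mxE.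
    rewrite (rowE0 _ _ (JX *m d x)) mulmxA -EJ (derive_frame _ _ dPhi).
    by rewrite [RHS]rowE0 mulmxA.
  have -> : (X x *m H) 0 i = (H *m (X x)^T) i 0.
    by rewrite -[in RHS]HT -trmx_mul [RHS]mxE.
  rewrite (rowE0 _ _ (H *m _)) mulmxA -EH (derive_trmx _ dd) -trmx_mul -trE.
  by rewrite [RHS]rowE0 mulmxA.
have rWh : r *m (W *m h x) = 0.
  apply/matrixP => b i; rewrite [RHS]mxE.
  have -> : (r *m (W *m h x)) b i = (r *m col i (W *m h x)) b 0.
    by rewrite colE [in RHS]mulmxA -colE [RHS]mxE.
  rewrite Wh.
  have := near_eq_derive (delta_mx 0 i) nrd.
  rewrite (derive_mulmx _ (differentiable_cst r x) dPd) !derive_cst mul0mx add0r.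
  by move=> ->; rewrite mxE.
have rW : r *m W = 0 by rewrite -[W](mulmxK hU) mulmxA rWh mul0mx.
have WTr : W^T *m r = 0.
  by rewrite -[r]opprK -rT mulmxN -trmx_mul rW trmx0 oppr0.
rewrite /local_lie_derivative eqK (near_eq_derive _ nP) (derive_mulmx _ dTr dPhi).
rewrite (derive_mulmx _ dT (differentiable_cst r x)) derive_cst mulmx0 addr0.
rewrite (derive_trmx _ dPhi) (nbhs_singleton nP).
have -> : 'D_(Z x) Phi x = Phi x *m K - W by rewrite /W opprB addrC subrK.
rewrite linearB/= !mulmxBl mulmxBr WTr mul0mx subr0.
rewrite -[_ *m r *m W]mulmxA rW mulmx0 subr0 trmx_mul !mulmxA subrr.
by [].
Unshelve. all: by end_near. Qed.

(** The maps [F (., y)] are local isometries of [h], and the one for [y0] is the identity;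
[u Phi] is their velocity at [y0] in the direction [u].  The Killing equation is the
derivative in [y] of the isometry condition; in it the Jacobian matrix of the
velocity appears as the derivative of the Jacobian matrices of the isometries. *)
Lemma killing_of_isometries (h Phi : 'rV[R]_n -> 'M[R]_n)
    (F : 'rV[R]_(n + n) -> 'rV[R]_n) (x0 y0 u : 'rV[R]_n) :
  twice_differentiable F (row_mx x0 y0) -> differentiable h x0 ->
  (\forall x \near x0, Phi x = 'J (fun y => F (row_mx x y)) y0) ->
  (\forall x \near x0, F (row_mx x y0) = x) ->
  (\forall y \near y0, h x0 = 'J (fun x => F (row_mx x y)) x0 *m
     h (F (row_mx x0 y)) *m ('J (fun x => F (row_mx x y)) x0)^T) ->
  killing_at h (fun y => u *m Phi y) x0.
Proof.
move=> d2F dh nPhi Fid iso; have [nF dF] := d2F.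
have dF0 := nbhs_singleton nF.
have [drl _] := derive_row_mxl y0 x0 0.
have [drr _] := derive_row_mxr x0 y0 0.
have nFl : \forall x \near x0, differentiable F (row_mx x y0).
  exact: (differentiable_continuous drl nF).
have nFr : \forall y \near y0, differentiable F (row_mx x0 y).
  exact: (differentiable_continuous drr nF).
pose X x := u *m Phi x.
pose S y := 'J (fun x => F (row_mx x y)) x0.
pose phi y := F (row_mx x0 y).
have phi0 : phi y0 = x0 by exact: (nbhs_singleton Fid).
have nX : \near x0, X x0 = 'D_(row_mx 0 u) F (row_mx x0 y0).
  apply: filterS2 nPhi nFl => z Pz dFz; rewrite /X Pz.
  by have [_ ->] := derive_slicer u dFz.
have dX : differentiable X x0.
  have := differentiable_comp drl (dF (row_mx 0 u)).
  by apply: near_eq_differentiable; apply: filterS nX => z ->.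
have [J eqJ EJ] := jacobian_exists dX.
have nS (v : 'rV[R]_n) : \near y0, v *m S y0 = 'D_(row_mx v 0) F (row_mx x0 y0).
  apply: filterS nFr => z dFz.
  by rewrite /S; have [_ ->] := derive_slicel v dFz.
have dvS (v : 'rV[R]_n) : differentiable (fun y => v *m S y) y0.
  have := differentiable_comp drr (dF (row_mx v 0)).
  by apply: near_eq_differentiable; apply: filterS (nS v) => z ->.
have dS : differentiable S y0 by exact: differentiable_rows.
have S0 : S y0 = 1%:M.
  apply/row_matrixP => i; rewrite !rowE mulmx1.
  have [dFl _] := derive_slicel 0 dF0.
  rewrite /S -(deriveEjacobian _ dFl) -[RHS](derive_id x0 (delta_mx 0 i)).
  exact: near_eq_derive.
(* The exchange of the derivatives in x and y. *)
have DS : 'D_u S y0 = J.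
  apply/row_matrixP => i; rewrite !rowE -EJ; set v := delta_mx 0 i.
  have <- : 'D_u (fun y => v *m S y) y0 = v *m 'D_u S y0 by exact: derive_frame.
  rewrite (near_eq_derive _ (nS v)) (near_eq_derive _ nX).
  have [_ Dr] := derive_row_mxr x0 y0 u; have [_ Dl] := derive_row_mxl y0 x0 v.
  apply: etrans (derive_comp u drr (dF (row_mx v 0))) _; rewrite Dr.
  apply: etrans (esym (derive_comp v drl (dF (row_mx 0 u)))); rewrite Dl.
  exact: derive_mixed_row.
have [dphi Dphi] := derive_slicer u dF0.
have DphiX : 'D_u phi y0 = X x0.
  by rewrite (nbhs_singleton nX) -Dphi; exact: deriveEjacobian.
have dh0 : differentiable h (phi y0) by rewrite phi0.
have dhphi : differentiable (h \o phi) y0 := differentiable_comp dphi dh0.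
have Dhphi : 'D_u (h \o phi) y0 = 'D_(X x0) h x0.
  apply: etrans (derive_comp u dphi dh0) _.
  by rewrite -[in RHS]DphiX -[x0 in RHS]phi0.
have dST := differentiable_trmx dS.
have dSh := differentiable_mulmx dS dhphi.
have := near_eq_derive u iso.
rewrite derive_cst => /esym/(etrans (esym (derive_mulmx u dSh dST))).
rewrite (derive_mulmx u dS dhphi) (derive_trmx u dS) S0 DS Dhphi /= phi0.
rewrite trmx1 mulmx1 !mul1mx => E.
by rewrite /killing_at -/X eqJ addrA [X in X + _]addrC.
Qed.

End LocalKilling.

(** * Charts *)

Section Charts.
Context {R : realType} {n : nat} {M : smoothManifoldType R n}.
Implicit Types (p q r s : M) (x : 'rV[R]_n) (f k : M -> M).

Lemma chart_cod_chart p q : chart_dom p q -> chart_cod p (chart p q).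
Proof. by move=> pq; exists q. Qed.

Lemma chart_cod_center p : chart_cod p (chart p p).
Proof. exact/chart_cod_chart/chart_dom_center. Qed.

Lemma chart_inv_center p : chart_inv p (chart p p) = p.
Proof. exact/chartK/chart_dom_center. Qed.

Lemma chart_inv_dom p x : chart_cod p x -> chart_dom p (chart_inv p x).
Proof. by move=> [q pq <-]; rewrite chartK. Qed.

Lemma chart_invK p x : chart_cod p x -> chart p (chart_inv p x) = x.
Proof. by move=> [q pq <-]; rewrite chartK. Qed.

Lemma near_chart_cod p x : chart_cod p x -> \forall y \near x, chart_cod p y.
Proof. by move=> px; apply: open_nbhs_nbhs; split => //; exact: chart_cod_open. Qed.

Lemma near_chart_inv p x (U : set M) : chart_cod p x -> nbhs (chart_inv p x) U ->
  \forall y \near x, U (chart_inv p y).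
Proof. by move=> px pU; have /(_ U pU) := chart_inv_continuous p x px. Qed.

Lemma nbhs_chart_dom p q : chart_dom p q -> nbhs q (chart_dom p).
Proof. by move=> pq; apply: open_nbhs_nbhs; split => //; exact: chart_dom_open. Qed.

(** Transition maps are the case [f = id]; the tangent map of [f] at [p] is a Jacobian
matrix of [in_charts p (f p) f]. *)
Definition in_charts p r f : 'rV[R]_n -> 'rV[R]_n := chart r \o f \o chart_inv p.

Lemma jacobian_in_charts_comp p r s f k x : chart_cod p x ->
  {for chart_inv p x, continuous f} -> chart_dom r (f (chart_inv p x)) ->
  differentiable (in_charts p r f) x ->
  differentiable (in_charts r s k) (in_charts p r f x) ->
  'J (in_charts p s (k \o f)) x =
  'J (in_charts p r f) x *m 'J (in_charts r s k) (in_charts p r f x).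
Proof.
move=> px cf rf df dk; rewrite -(jacobian_comp df dk); apply/esym/near_eq_jacobian.
  exact: differentiable_comp.
have nrf := near_chart_inv px (cf _ (nbhs_chart_dom rf)).
by apply: filterS nrf => y ry; rewrite /in_charts /= chartK.
Qed.

Lemma differentiable_transition p q x : chart_cod p x ->
  chart_dom q (chart_inv p x) -> differentiable (in_charts p q id) x.
Proof.
move=> px qx; apply: (chart_smooth p q [::]).
by exists (chart_inv p x); [split => //; exact: chart_inv_dom|exact: chart_invK].
Qed.

Lemma jacobian_in_charts_id p x : chart_cod p x -> 'J (in_charts p p id) x = 1%:M.
Proof.
move=> px; have did := differentiable_transition px (chart_inv_dom px).
have nid : \forall y \near x, in_charts p p id y = id y.
  by apply: filterS (near_chart_cod px) => y py; exact: chart_invK.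
apply: jacobian_eq => // v; rewrite mulmx1 -[RHS](derive_id x v).
exact: near_eq_derive.
Qed.

Lemma transition_inv p q x : chart_cod p x -> chart_dom q (chart_inv p x) ->
  transition p q x *m transition q p (chart q (chart_inv p x)) = 1%:M.
Proof.
move=> px qx.
rewrite -(jacobian_in_charts_id px).
apply/esym/(@jacobian_in_charts_comp p q p id id) => //.
- exact: differentiable_transition.
- apply: differentiable_transition; first exact: chart_cod_chart.
  by rewrite chartK//; exact: chart_inv_dom.
Qed.

Lemma transition_unit p q x : chart_cod p x -> chart_dom q (chart_inv p x) ->
  transition p q x \in unitmx.
Proof. move=> px qx; exact: (proj1 (mulmx1_unit (transition_inv px qx))). Qed.

End Charts.

(** * Tensor fields in a chart *)

Lemma invmx_congruence (F : fieldType) n (A B S : 'M[F]_n) :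
  A *m B = 1%:M -> S \in unitmx ->
  B^T *m invmx S *m B = invmx (A *m S *m A^T).
Proof.
move=> AB SU; have [AU _] := mulmx1_unit AB.
have MU : A *m S *m A^T \in unitmx by rewrite !unitmx_mul unitmx_tr AU SU.
have BA := mulmx1C AB.
have BAT : A^T *m B^T = 1%:M by rewrite -trmx_mul BA trmx1.
rewrite -[LHS]mul1mx -(mulVmx MU) -[LHS]mulmxA -[RHS]mulmx1; congr (_ *m _).
rewrite !mulmxA -[_ *m A^T *m B^T]mulmxA BAT mulmx1.
by rewrite -[A *m S *m invmx S]mulmxA mulmxV// mulmx1.
Qed.

Section TensorsInCharts.
Context {R : realType} {n : nat} {M : smoothManifoldType R n}.
Implicit Types (g P : M -> 'M[R]_n) (p : M) (x : 'rV[R]_n).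

Lemma metric_unit g p : riemannian_metric g -> g p \in unitmx.
Proof.
move=> [_ gpos _]; rewrite -row_free_unit -kermx_eq0; apply/negPn/negP => k0.
have /rowV0Pn[v vk v0] := k0.
have := gpos p v v0; rewrite (sub_kermxP vk) mul0mx mxE.
by rewrite ltxx.
Qed.

Lemma metric_in_sym g p x : riemannian_metric g ->
  (metric_in p g x)^T = metric_in p g x.
Proof. by move=> [gT _ _]; rewrite /metric_in !trmx_mul trmxK gT mulmxA. Qed.

Lemma metric_in_unit g p x : riemannian_metric g -> chart_cod p x ->
  metric_in p g x \in unitmx.
Proof.
move=> gR px; have := transition_unit px (chart_dom_center (chart_inv p x)).
move=> tU; rewrite /metric_in !unitmx_mul unitmx_tr tU (metric_unit _ gR).
by [].
Qed.

Lemma differentiable_metric_in g p x : riemannian_metric g -> chart_cod p x ->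
  differentiable (metric_in p g) x.
Proof. by move=> [_ _ gS] px; exact: (gS p [::]). Qed.

Lemma invmx_metric_in g p x : riemannian_metric g -> chart_cod p x ->
  let q := chart_inv p x in let B := transition q p (chart q q) in
  B^T *m invmx (g q) *m B = invmx (metric_in p g x).
Proof.
move=> gR px /=; set q := chart_inv p x; set B := transition q p _.
have AB : transition p q x *m B = 1%:M.
  exact: transition_inv px (chart_dom_center _).
exact: invmx_congruence AB (metric_unit _ gR).
Qed.

Lemma smooth_fun_coordinate (p : M) (f : M -> R) (U : set M) x : smooth_fun_on U f ->
  chart_cod p x -> U (chart_inv p x) -> forall s,
  differentiable (foldr partial (f \o chart_inv p) s) x.
Proof.
move=> sf px Ux s; apply: (sf p s).
by exists (chart_inv p x); [split => //; exact: chart_inv_dom|exact: chart_invK].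
Qed.

Definition differential_in p (f : M -> R) (x : 'rV[R]_n) : 'cV[R]_n :=
  \col_i partial i (f \o chart_inv p) x.

Lemma differential_transition p (f : M -> R) (U : set M) x : smooth_fun_on U f ->
  chart_cod p x -> U (chart_inv p x) ->
  differential f (chart_inv p x) = transition (chart_inv p x) p
    (chart (chart_inv p x) (chart_inv p x)) *m differential_in p f x.
Proof.
move=> sf px Ux; set q := chart_inv p x.
have df : differentiable (f \o chart_inv p) x := smooth_fun_coordinate sf px Ux [::].
have qq := chart_cod_center q.
have pq : chart_dom p (chart_inv q (chart q q)).
  by rewrite chart_inv_center; exact: chart_inv_dom.
have dt : differentiable (chart p \o chart_inv q) (chart q q).
  exact: (differentiable_transition qq pq).
have tq : (chart p \o chart_inv q) (chart q q) = x.
  by rewrite /= chart_inv_center chart_invK.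
apply/colP => i; rewrite mxE.
have nf : \forall y \near chart q q, f (chart_inv q y) =
    ((f \o chart_inv p) \o (chart p \o chart_inv q)) y.
  have := near_chart_inv qq (nbhs_chart_dom pq); apply: filterS => y py /=.
  by rewrite chartK.
rewrite /partial (near_eq_derive _ nf).
have dfq : differentiable (f \o chart_inv p)
    ((chart p \o chart_inv q) (chart q q)) by rewrite tq.
apply: etrans (derive_comp _ dt dfq) _; rewrite tq.
apply: etrans (derive_delta _ df) _; rewrite [RHS]mxE; apply: eq_bigr => k _.
rewrite [differential_in _ _ _ _ _]mxE; congr (_ * _).
by rewrite (deriveEjacobian _ dt) -rowE mxE.
Qed.

Lemma vector_in_gradient g (f : M -> R) p (U : set M) x : riemannian_metric g ->
  smooth_fun_on U f -> chart_cod p x -> U (chart_inv p x) ->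
  vector_in p (gradient g f) x =
  (differential_in p f x)^T *m invmx (metric_in p g x).
Proof.
move=> gR sf px Ux; rewrite -(invmx_metric_in gR px) /vector_in /gradient.
by rewrite (differential_transition sf px Ux) trmx_mul !mulmxA.
Qed.

Lemma casimir_in P (f : M -> R) p (U : set M) x : casimir P U f ->
  chart_cod p x -> U (chart_inv p x) ->
  (differential_in p f x)^T *m bivector_in p P x = 0.
Proof.
move=> [sf cf] px Ux; have := cf _ Ux.
rewrite /anchor (differential_transition sf px Ux) trmx_mul /bivector_in.
by rewrite !mulmxA => ->; rewrite mul0mx.
Qed.

Lemma differentiable_differential_in p (f : M -> R) (U : set M) x :
  smooth_fun_on U f -> chart_cod p x -> U (chart_inv p x) ->
  differentiable (differential_in p f) x.
Proof.
move=> sf px Ux; apply/differentiable_mxP => i j; under eq_fun do rewrite mxE.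
exact: (smooth_fun_coordinate sf px Ux [:: i]).
Qed.

Lemma hessian_sym p (f : M -> R) (U : set M) x : open U ->
  smooth_fun_on U f -> chart_cod p x -> U (chart_inv p x) ->
  let H := 'J (fun y => (differential_in p f y)^T) x in H^T = H.
Proof.
move=> oU sf px Ux H; have dd := differentiable_differential_in sf px Ux.
have ddT := differentiable_trmx dd.
have HE i j : H i j = partial i (partial j (f \o chart_inv p)) x.
  have Dfj : (fun y => (differential_in p f y)^T 0 j) = partial j (f \o chart_inv p).
    by apply/funext => y; rewrite 2!mxE.
  by rewrite -Dfj; exact: jacobianE.
apply/matrixP => i j; rewrite mxE !HE; apply: derive_mixed.
- have nU := near_chart_inv px (open_nbhs_nbhs (conj oU Ux)).
  apply: filterS2 (near_chart_cod px) nU => y py Uy.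
  exact: (smooth_fun_coordinate sf py Uy [::]).
- exact: (smooth_fun_coordinate sf px Ux [:: i]).
- exact: (smooth_fun_coordinate sf px Ux [:: j]).
Qed.

End TensorsInCharts.

(** * Translations in charts and the left-invariant frame *)

Section LieGroupCharts.
Context {R : realType} {n : nat} {G : lieGroupType R n}.
Implicit Types (a p q r : G) (x y u v : 'rV[R]_n).

Definition mul_in_charts p q r (z : 'rV[R]_(n + n)) : 'rV[R]_n :=
  chart r (chart_inv p (lsubmx z) * chart_inv q (rsubmx z))%g.

Lemma mul_in_charts_row p q r x y :
  mul_in_charts p q r (row_mx x y) = chart r (chart_inv p x * chart_inv q y)%g.
Proof. by rewrite /mul_in_charts row_mxKl row_mxKr. Qed.

Lemma mulg_continuous : continuous (fun z : G * G => (z.1 * z.2)%g).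
Proof. by have [] := @mulg_smooth R n G. Qed.

Lemma continuous_mulg (T : topologicalType) (f k : T -> G) z :
  {for z, continuous f} -> {for z, continuous k} ->
  {for z, continuous (fun w => f w * k w)%g}.
Proof.
move=> cf ck; apply: (@continuous_comp _ _ _ (fun w => (f w, k w))
  (fun z : G * G => (z.1 * z.2)%g)); last exact: mulg_continuous.
by apply: cvg_pair; [exact: cf|exact: ck].
Qed.

Lemma mulgl_continuous a : continuous (fun q : G => (a * q)%g).
Proof. by move=> q; apply: continuous_mulg; [exact: cvg_cst|exact: cvg_id]. Qed.

Lemma mulgr_continuous a : continuous (fun q : G => (q * a)%g).
Proof. by move=> q; apply: continuous_mulg; [exact: cvg_id|exact: cvg_cst]. Qed.

Lemma mul_in_charts_twice_differentiable p q r x y :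
  chart_cod p x -> chart_cod q y ->
  chart_dom r (chart_inv p x * chart_inv q y)%g ->
  twice_differentiable (mul_in_charts p q r) (row_mx x y).
Proof.
move=> px qy rxy.
pose U := [set z : 'rV[R]_(n + n) | [/\ chart_cod p (lsubmx z),
  chart_cod q (rsubmx z) &
  chart_dom r (chart_inv p (lsubmx z) * chart_inv q (rsubmx z))%g]].
have sU : smooth_on U (mul_in_charts p q r).
  by have [_ /(_ p q r)] := @mulg_smooth R n G.
have Uxy : U (row_mx x y) by split; rewrite ?row_mxKl ?row_mxKr.
have oU : open U.
  rewrite openE => z [pz qz rz]; rewrite /interior.
  have cl : {for z, continuous (@lsubmx R 1 n n)} by exact: continuous_lsubmx.
  have cr : {for z, continuous (@rsubmx R 1 n n)} by exact: continuous_rsubmx.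
  have np : \forall w \near z, chart_cod p (lsubmx w) by exact/cl/near_chart_cod.
  have nq : \forall w \near z, chart_cod q (rsubmx w) by exact/cr/near_chart_cod.
  have c1 : {for z, continuous (chart_inv p \o @lsubmx R 1 n n)}.
    by apply: continuous_comp; [|exact: chart_inv_continuous].
  have c2 : {for z, continuous (chart_inv q \o @rsubmx R 1 n n)}.
    by apply: continuous_comp; [|exact: chart_inv_continuous].
  have c3 : {for z, continuous (fun w =>
      (chart_inv p (lsubmx w) * chart_inv q (rsubmx w))%g)}.
    exact: continuous_mulg c1 c2.
  have nr : \forall w \near z,
     chart_dom r (chart_inv p (lsubmx w) * chart_inv q (rsubmx w))%g.
    exact/c3/nbhs_chart_dom.
  by apply: filterS3 np nq nr => w; split.
exact: smooth_on_twice_differentiable oU Uxy sU.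
Qed.

Lemma mulgl_in_charts a q r : in_charts q r (fun p => a * p)%g =
  (fun y => mul_in_charts a q r (row_mx (chart a a) y)).
Proof.
by apply/funext => y; rewrite mul_in_charts_row chart_inv_center.
Qed.

Lemma mulgr_in_charts a q r : in_charts q r (fun p => p * a)%g =
  (fun y => mul_in_charts q a r (row_mx y (chart a a))).
Proof.
by apply/funext => y; rewrite mul_in_charts_row chart_inv_center.
Qed.

Lemma differentiable_mulgl a q r y : chart_cod q y ->
  chart_dom r (a * chart_inv q y)%g ->
  differentiable (in_charts q r (fun p => a * p)%g) y.
Proof.
move=> qy ry; rewrite mulgl_in_charts.
suff dF : differentiable (mul_in_charts a q r) (row_mx (chart a a) y).
  by have [] := derive_slicer 0 dF.
apply/twice_differentiable_diff/mul_in_charts_twice_differentiable => //.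
  exact: chart_cod_center.
by rewrite chart_inv_center.
Qed.

Lemma differentiable_mulgr a q r y : chart_cod q y ->
  chart_dom r (chart_inv q y * a)%g ->
  differentiable (in_charts q r (fun p => p * a)%g) y.
Proof.
move=> qy ry; rewrite mulgr_in_charts.
suff dF : differentiable (mul_in_charts q a r) (row_mx y (chart a a)).
  by have [] := derive_slicel 0 dF.
apply/twice_differentiable_diff/mul_in_charts_twice_differentiable => //.
  exact: chart_cod_center.
by rewrite chart_inv_center.
Qed.

Lemma near_mulgl_dom a q r y : chart_cod q y -> chart_dom r (a * chart_inv q y)%g ->
  \forall z \near y, chart_dom r (a * chart_inv q z)%g.
Proof.
move=> qy ry; have nd : nbhs (chart_inv q y) [set b | chart_dom r (a * b)%g].
  exact: mulgl_continuous (nbhs_chart_dom ry).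
exact: near_chart_inv qy nd.
Qed.

(** The rows are, in [chart p], the left-invariant fields extending the standard basis
of the tangent space at the unit. *)
Definition left_frame p x : 'M[R]_n :=
  'J (in_charts 1%g p (fun q => chart_inv p x * q)%g) (chart (1%g : G) 1%g).

Lemma left_frameE p x : left_frame p x =
  'J (fun y => mul_in_charts p 1%g p (row_mx x y)) (chart (1%g : G) 1%g).
Proof.
by congr ('J _ _); apply/funext => y; rewrite mul_in_charts_row.
Qed.

Lemma differentiable_left_frame p x : chart_cod p x ->
  differentiable (left_frame p) x.
Proof.
move=> px; rewrite (_ : left_frame p = fun x => 'J (fun y =>
  mul_in_charts p 1%g p (row_mx x y)) (chart (1%g : G) 1%g)); last first.
  by apply/funext => z; exact: left_frameE.
apply/differentiable_jacobian_slice/mul_in_charts_twice_differentiable => //.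
  exact: chart_cod_center.
by rewrite chart_inv_center mulg1; exact: chart_inv_dom.
Qed.

Lemma tangent_mulgl_transition p x : chart_cod p x ->
  tangent_map (fun q => chart_inv p x * q)%g (1%g : G) *m
    transition (chart_inv p x) p (chart (chart_inv p x) (chart_inv p x)) =
  left_frame p x.
Proof.
move=> px; set q := chart_inv p x.
have c1 := chart_cod_center (1%g : G).
have q1 : (q * chart_inv 1%g (chart (1%g : G) 1%g))%g = q.
  by rewrite chart_inv_center mulg1.
rewrite /tangent_map [(q * 1)%g]mulg1.
have E : in_charts 1%g q (fun k => q * k)%g (chart (1%g : G) 1%g) = chart q q.
  by rewrite /in_charts /= q1.
have := @jacobian_in_charts_comp _ _ G 1%g q p (fun k => q * k)%g id _ c1.
rewrite E => /(_ (@mulgl_continuous q _)) <- //.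
- by rewrite q1; exact: chart_dom_center.
- by apply: differentiable_mulgl => //; rewrite q1; exact: chart_dom_center.
- apply: differentiable_transition; first exact: chart_cod_center.
  by rewrite chart_inv_center; exact: chart_inv_dom.
Qed.

(** The left translation by the inverse element provides the inverse matrix. *)
Lemma left_frame_unit p x : chart_cod p x -> left_frame p x \in unitmx.
Proof.
move=> px; set q := chart_inv p x.
have c1 := chart_cod_center (1%g : G).
have q1 : (q * chart_inv 1%g (chart (1%g : G) 1%g))%g = q.
  by rewrite chart_inv_center mulg1.
have E : in_charts 1%g p (fun k => q * k)%g (chart (1%g : G) 1%g) = x.
  by rewrite /in_charts /= q1 chart_invK.
have := @jacobian_in_charts_comp _ _ G 1%g p 1%g (fun k => q * k)%g
  (fun k => q^-1 * k)%g _ c1 (@mulgl_continuous q _).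
rewrite q1 E => /(_ (chart_inv_dom px)).
have -> : (fun k => q^-1 * k)%g \o (fun k => q * k)%g = id.
  by apply/funext => k /=; rewrite mulgA mulVg mul1g.
rewrite (jacobian_in_charts_id c1) => H.
apply: (proj1 (mulmx1_unit (esym (H _ _)))).
- by apply: differentiable_mulgl => //; rewrite q1; exact: chart_inv_dom.
- by apply: differentiable_mulgl => //; rewrite mulVg; exact: chart_dom_center.
Qed.

Lemma vector_in_left_invariant p u x : chart_cod p x ->
  vector_in p (left_invariant_field u : G -> _) x = u *m left_frame p x.
Proof.
move=> px; rewrite /vector_in /left_invariant_field -mulmxA.
by rewrite tangent_mulgl_transition.
Qed.

Lemma bivector_in_left_invariant (P : G -> 'M[R]_n) p x :
  left_invariant_bivector P -> chart_cod p x ->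
  bivector_in p P x = (left_frame p x)^T *m P 1%g *m left_frame p x.
Proof.
move=> Pinv px; rewrite -(tangent_mulgl_transition px) /bivector_in.
have := Pinv (chart_inv p x) 1%g; rewrite [(_ * 1)%g]mulg1 /= => ->.
by rewrite trmx_mul !mulmxA.
Qed.

(** * Left-invariant fields: Killing equation and brackets *)

(** The isometries are the right translations by points near the unit. *)
Lemma killing_left_invariant (g : G -> 'M[R]_n) p u : riemannian_metric g ->
  right_invariant_metric g ->
  killing_at (metric_in p g) (fun y => u *m left_frame p y) (chart p p).
Proof.
move=> gR ginv.
have pp := chart_cod_center p; have c1 := chart_cod_center (1%g : G).
have p1 : (chart_inv p (chart p p) * chart_inv 1%g (chart (1%g : G) 1%g))%g = p.
  by rewrite !chart_inv_center mulg1.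
have dp1 : chart_dom p
    (chart_inv p (chart p p) * chart_inv 1%g (chart (1%g : G) 1%g))%g.
  by rewrite p1; exact: chart_dom_center.
have nframe : \forall x \near chart p p, left_frame p x =
    'J (fun y => mul_in_charts p 1%g p (row_mx x y)) (chart (1%g : G) 1%g).
  by apply: filterS (near_chart_cod pp) => x _; exact: left_frameE.
have nid : \forall x \near chart p p,
    mul_in_charts p 1%g p (row_mx x (chart (1%g : G) 1%g)) = x.
  apply: filterS (near_chart_cod pp) => x px.
  by rewrite mul_in_charts_row chart_inv_center mulg1 chart_invK.
have nL : \forall y \near chart (1%g : G) 1%g, chart_dom p (p * chart_inv 1 y)%g.
  by apply: near_mulgl_dom => //; rewrite chart_inv_center mulg1;
    exact: chart_dom_center.
suff iso : \forall y \near chart (1%g : G) 1%g, metric_in p g (chart p p) =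
    'J (fun x => mul_in_charts p 1%g p (row_mx x y)) (chart p p) *m
     metric_in p g (mul_in_charts p 1%g p (row_mx (chart p p) y)) *m
    ('J (fun x => mul_in_charts p 1%g p (row_mx x y)) (chart p p))^T.
  apply: killing_of_isometries _ _ nframe nid iso.
  - exact: mul_in_charts_twice_differentiable.
  - exact: differentiable_metric_in.
apply: filterS nL => y py.
set a := chart_inv 1%g y in py *.
have -> : (fun x => mul_in_charts p 1%g p (row_mx x y)) =
    in_charts p p (fun q => q * a)%g.
  by apply/funext => x; rewrite mul_in_charts_row.
rewrite mul_in_charts_row chart_inv_center -/a.
have gp : metric_in p g (chart p p) = g p.
  rewrite /metric_in chart_inv_center.
  by rewrite [transition p p _](jacobian_in_charts_id pp) mul1mx trmx1 mulmx1.
rewrite gp (ginv a p) /metric_in (chartK p _ py).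
have -> : tangent_map (fun q => q * a)%g p =
    'J (in_charts p p (fun q => q * a)%g) (chart p p) *m
    transition p (p * a)%g (chart p (p * a)%g).
  have E : in_charts p p (fun q => q * a)%g (chart p p) = chart p (p * a)%g.
    by rewrite /in_charts /= chart_inv_center.
  rewrite -E; apply: (@jacobian_in_charts_comp _ _ G p p (p * a)%g
    (fun q => q * a)%g id _ pp); rewrite ?E.
  - by rewrite chart_inv_center; exact: mulgr_continuous.
  - by rewrite chart_inv_center.
  - by apply: differentiable_mulgr => //; rewrite chart_inv_center.
  - apply: differentiable_transition; first exact: chart_cod_chart.
    by rewrite chartK//; exact: chart_dom_center.
by rewrite trmx_mul !mulmxA.
Qed.

Lemma lie_bracketE u v : lie_bracket (G := G) u v =
  local_bracket (fun y => u *m left_frame (1%g : G) y)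
    (fun y => v *m left_frame (1%g : G) y) (chart (1%g : G) 1%g).
Proof.
apply: near_eq_local_bracket;
  apply: filterS (near_chart_cod (chart_cod_center (1%g : G))) => y py;
  exact: vector_in_left_invariant.
Qed.

Lemma lie_bracketC u v : lie_bracket (G := G) u v = - lie_bracket (G := G) v u.
Proof. by rewrite !lie_bracketE /local_bracket opprB. Qed.

Lemma lie_bracket_linear v : linear (lie_bracket (G := G) ^~ v).
Proof.
have dF := differentiable_left_frame (chart_cod_center (1%g : G)).
move=> c u w; rewrite !lie_bracketE !(local_bracket_frame _ _ dF).
set F0 := left_frame _ _.
have [D DE Dlin] : exists2 D : 'rV[R]_n -> 'M[R]_n,
    forall z, 'D_(z *m F0) (left_frame (1%g : G)) (chart (1%g : G) 1%g) = D z &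
    linear D.
  exists (fun z => 'd (left_frame (1%g : G)) (chart (1%g : G) 1%g) (z *m F0)).
    by move=> z; exact: deriveE.
  by move=> a z1 z2; rewrite mulmxDl -scalemxAl linearP.
rewrite !DE Dlin mulmxDr mulmxDl -scalemxAr -scalemxAl scalerBr opprD.
exact: addrACA.
Qed.

(** Left-invariant fields are related to themselves by the left translation by [p],
which takes the unit to [p]. *)
Lemma local_bracket_left_frame p u v :
  local_bracket (fun y => u *m left_frame p y) (fun y => v *m left_frame p y)
    (chart p p) =
  lie_bracket (G := G) u v *m
    'J (in_charts 1%g p (fun q => p * q)%g) (chart (1%g : G) 1%g).
Proof.
have pp := chart_cod_center p; have c1 := chart_cod_center (1%g : G).
pose phi := in_charts 1%g p (fun q => p * q)%g.
have phi1 : phi (chart (1%g : G) 1%g) = chart p p.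
  by rewrite /phi /in_charts /= chart_inv_center mulg1.
have dp1 : chart_dom p
    (chart_inv p (chart p p) * chart_inv 1%g (chart (1%g : G) 1%g))%g.
  by rewrite !chart_inv_center mulg1; exact: chart_dom_center.
rewrite lie_bracketE -phi1; apply: local_bracket_related.
- rewrite /phi mulgl_in_charts; apply: twice_differentiable_slicer.
  exact: mul_in_charts_twice_differentiable.
- exact: differentiable_left_frame.
- by rewrite phi1; exact: differentiable_left_frame.
have nL : \forall y \near chart (1%g : G) 1%g, chart_dom p (p * chart_inv 1 y)%g.
  by apply: near_mulgl_dom => //; rewrite chart_inv_center mulg1;
    exact: chart_dom_center.
apply: filterS2 (near_chart_cod c1) nL => y y1 py.
set q := chart_inv 1%g y in py.
have q1 : (q * chart_inv 1%g (chart (1%g : G) 1%g))%g = q.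
  by rewrite chart_inv_center mulg1.
have E : in_charts 1%g 1%g (fun k => q * k)%g (chart (1%g : G) 1%g) = y.
  by rewrite /in_charts /= q1 chart_invK.
have := @jacobian_in_charts_comp _ _ G 1%g 1%g p (fun k => q * k)%g
  (fun k => p * k)%g _ c1 (@mulgl_continuous q _).
rewrite q1 E => /(_ (chart_inv_dom y1)) <-.
- rewrite /left_frame (_ : chart_inv p (phi y) = (p * q)%g); last first.
    by rewrite /phi /in_charts /= chartK.
  by congr ('J (in_charts _ _ _) _); apply/funext => k /=; rewrite mulgA.
- by apply: differentiable_mulgl => //; rewrite q1; exact: chart_inv_dom.
- exact: differentiable_mulgl.
Qed.

End LieGroupCharts.

(** * Unimodular left-invariant Poisson tensors *)

Section UnimodularPoisson.
Context {R : realType} {n : nat} {G : lieGroupType R n} {P g : G -> 'M[R]_n}.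
Context (PU : unimodular_left_invariant_poisson P).
Context (gR : riemannian_metric g) (ginv : right_invariant_metric g).
Implicit Types p : G.

Let r := P 1%g.

Lemma rmatrix_antisym : r^T = - r.
Proof. by have [_ [rT _] _] := PU. Qed.

Lemma near_bivector_in p : \forall x \near chart p p,
  bivector_in p P x = (left_frame p x)^T *m r *m left_frame p x.
Proof.
have [[_ Pinv] _ _] := PU.
apply: filterS (near_chart_cod (chart_cod_center p)) => x px.
exact: bivector_in_left_invariant.
Qed.

Lemma sum_left_frame_bracket p :
  \sum_a \sum_b r a b *: local_bracket (fun y => delta_mx 0 a *m left_frame p y)
    (fun y => delta_mx 0 b *m left_frame p y) (chart p p) = 0.
Proof.
have [_ [rT cybe] unim] := PU.
have sum0 := unimodular_rmatrix_bracket (@lie_bracket_linear R n G)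
  (@lie_bracketC R n G) rT cybe unim.
under eq_bigr => a _ do under eq_bigr => b _ do
  rewrite local_bracket_left_frame scalemxAl.
under eq_bigr => a _ do rewrite -mulmx_suml.
by rewrite -mulmx_suml sum0 mul0mx.
Qed.

Lemma divergence_eq0 p : divergence g P p = 0.
Proof.
have pp := chart_cod_center p.
rewrite /divergence (divergence_killing_frame rmatrix_antisym (near_bivector_in p)).
- have := sum_derive_bracket (left_frame p) (chart p p) rmatrix_antisym.
  by rewrite sum_left_frame_bracket => /esym/eqP; rewrite -scaler_nat scaler_eq0 pnatr_eq0 => /eqP.
- exact: differentiable_left_frame.
- exact: differentiable_metric_in.
- by move=> x; exact: metric_in_sym.
- exact: metric_in_unit.
- by move=> u; exact: killing_left_invariant.
Qed.

Lemma lie_derivative_gradient_eq0 (U : set G) (f : G -> R) p : open U ->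
  casimir P U f -> U p -> lie_derivative (gradient g f) P p = 0.
Proof.
move=> oU Cf Up; have [sf _] := Cf.
have [[_ Pinv] _ _] := PU.
have pp := chart_cod_center p.
have Upp : U (chart_inv p (chart p p)) by rewrite chart_inv_center.
have nU := near_chart_inv pp (open_nbhs_nbhs (conj oU Upp)).
have npp := near_chart_cod pp.
have nu : \forall x \near chart p p, metric_in p g x \in unitmx.
  by apply: filterS npp => x px; exact: metric_in_unit.
have nZ : \forall x \near chart p p, vector_in p (gradient g f) x =
    (differential_in p f x)^T *m invmx (metric_in p g x).
  by apply: filterS2 npp nU => x px Ux; exact: vector_in_gradient gR sf px Ux.
have nrd : \forall x \near chart p p,
    r *m (left_frame p x *m differential_in p f x) = 0.
  apply: filterS2 npp nU => x px Ux.
  have /eqP := casimir_in Cf px Ux.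
  rewrite (bivector_in_left_invariant Pinv px) mulmxA.
  rewrite -(mul0mx _ (left_frame p x)) => /eqP.
  move=> /(congr1 (mulmx^~ (invmx (left_frame p x)))).
  rewrite !mulmxK ?left_frame_unit// => /(congr1 trmx).
  rewrite mulmxA trmx0 !trmx_mul !trmxK rmatrix_antisym mulNmx => /eqP.
  by rewrite oppr_eq0 => /eqP.
apply: (lie_derivative_gradient_killing rmatrix_antisym (near_bivector_in p)
  _ _ _ nu _ _ _ nZ nrd).
- exact: differentiable_left_frame.
- exact: differentiable_metric_in.
- by move=> x; exact: metric_in_sym.
- by move=> u; exact: killing_left_invariant.
- exact: differentiable_differential_in sf pp Upp.
- exact: hessian_sym oU sf pp Upp.
Qed.

End UnimodularPoisson.

Theorem corollary1p1 (R : realType) (n : nat) (G : lieGroupType R n)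
    (P g : G -> 'M[R]_n) :
  unimodular_left_invariant_poisson P ->
  riemannian_metric g -> right_invariant_metric g ->
  killing_poisson g P.
Proof.
move=> PU gR ginv; have [[Ppoisson _] _ _] := PU.
split=> //; first exact: divergence_eq0.
by move=> U f oU Cf p; exact: lie_derivative_gradient_eq0.
Qed.
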